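(* For every real $p>2$, $$\varepsilon_0(p)=\left[\frac pe\Big(\Gamma(p)-\int_0^1t^{p-1}e^t\,dt\Big)+1\right]^{1/p},$$ where $\varepsilon_0(p)$ is the John--Nirenberg constant of $\mathrm{BMO}^p$ on an interval.
   Context: For a finite interval $J$ and $\varphi\in L^1(J)$ (real-valued), $\langle\varphi\rangle_J=\frac1{|J|}\int_J\varphi$ is the average with respect to Lebesgue measure. For a finite interval $Q$ and $p>0$, $$\|\varphi\|_{\mathrm{BMO}^p(Q)}=\sup_{\text{intervals }J\subset Q}\big\langle|\varphi-\langle\varphi\rangle_J|^p\big\rangle_J^{1/p},$$ and $\mathrm{BMO}(Q)=\{\varphi\in L^1(Q):\|\varphi\|_{\mathrm{BMO}^p(Q)}<\infty\}$ (this set does not depend on $p$, since all these $p$-based (quasi-)norms are equivalent). The John--Nirenberg constant $\varepsilon_0(p)$ is the largest possible number with the following property: for every $\varepsilon\in[0,\varepsilon_0(p))$ there is a number $C(\varepsilon,p)>0$ such that for every finite interval $Q$, every $\varphi\in\mathrm{BMO}(Q)$ with $\|\varphi\|_{\mathrm{BMO}^p(Q)}\le\varepsilon$, and every interval $J\subset Q$, $$\langle e^{\varphi}\rangle_J\le C(\varepsilon,p)\,e^{\langle\varphi\rangle_J}.$$ $\Gamma(p)$ is the Euler Gamma function. *)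

(* Defs.v *)
From HB Require Import structures.
From mathcomp Require Import all_boot all_order all_algebra.
From mathcomp Require Import all_classical all_reals all_analysis.

Set Implicit Arguments.
Unset Strict Implicit.
Unset Printing Implicit Defensive.

Import Order.TTheory GRing.Theory Num.Theory.
Import numFieldNormedType.Exports.

Local Open Scope classical_set_scope.
Local Open Scope ring_scope.

Section JohnNirenberg.
Context {R : realType}.
Implicit Types (a b c d p e : R) (f phi : R -> R).

Local Notation mu := (@lebesgue_measure R).

(* A finite interval is given by its endpoints c < d. Whether the endpoints
   belong to it does not affect averages, so the closed interval is used.
   The average is extended-real valued: it may be +oo when f >= 0 is not
   integrable. *)
Definition eaverage c d f : \bar R :=
  ((d - c)^-1%:E * \int[mu]_(x in `[c, d]) (f x)%:E)%E.

(* Meaningful when f is integrable on [c, d]. *)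
Definition average c d f : R := fine (eaverage c d f).

Definition bmo_norm p a b phi : \bar R :=
  ereal_sup [set t : \bar R | exists c d : R,
    [/\ a <= c, c < d, d <= b &
        t = poweR (eaverage c d (fun x => `|phi x - average c d phi| `^ p))
                  p^-1]].

(* BMO([a, b]) for the p-based quasi-norm; as a set it does not depend on
   p > 0. *)
Definition BMO p a b : set (R -> R) :=
  [set phi | mu.-integrable `[a, b] (EFin \o phi) /\
             (bmo_norm p a b phi < +oo)%E].

(* C may depend on p and e only. *)
Definition john_nirenberg_at p e : Prop :=
  exists2 C : R, 0 < C &
    forall a b phi, a < b -> BMO p a b phi -> (bmo_norm p a b phi <= e%:E)%E ->
    forall c d, a <= c -> c < d -> d <= b ->
    (eaverage c d (expR \o phi) <= (C * expR (average c d phi))%:E)%E.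

Definition john_nirenberg_below p : set R :=
  [set e0 | forall e, 0 <= e < e0 -> john_nirenberg_at p e].

Definition is_john_nirenberg_constant p (e0 : R) : Prop :=
  john_nirenberg_below p e0 /\ ubound (john_nirenberg_below p) e0.

(* Euler's Gamma function, for positive arguments. *)
Definition Gamma (s : R) : R :=
  \int[mu]_(t in `]0, +oo[) (t `^ (s - 1) * expR (- t)).

End JohnNirenberg.

(* Main.v *)
Require Import Defs.
From mathcomp Require Import all_boot all_order all_algebra.
From mathcomp Require Import all_classical all_reals all_analysis.
From mathcomp Require Import unstable measurable_realfun lra.
Import Order.TTheory GRing.Theory Num.Theory.
Import numFieldNormedType.Exports.
Local Open Scope classical_set_scope.
Local Open Scope ring_scope.

Set Implicit Arguments.
Unset Strict Implicit.
Unset Printing Implicit Defensive.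

(* Let J be the p-th power of the claimed constant, that is, the mean of
   |X - 1|^p for X exponentially distributed.

   For phi(t) = - ln t on [0, 1], the distribution of phi minus its mean on
   [0, d] is that of X - 1, and on [c, d] with c > 0 it is less spread in the
   convex order: the decreasing rearrangement of X - 1 to [c, d] is the sum of
   phi minus its mean and of another decreasing function of mean zero.  So the
   norm of phi is at most J^(1/p), whereas exp phi is not integrable.

   Conversely, let the norm be at most e on [c, d] and l >= m, where m is the
   average of phi.  A rising sun lemma gives an open set U l, decreasing in l,
   whose components have average exactly l and off which phi <= l; hence the
   integral of |phi - l|^p over U l is at most e^p |U l|.  Choose l nearly
   maximising M l = (integral of exp phi over U l) / (|U l| exp l), with exp phi
   truncated.  For b >= 0, comparing M (l + b) with M l, and bounding phi by
   l + b off U (l + b), yields |U (l + b)| >= (1 - small) exp (- b) |U l| as soon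
   as M l is large.  Replacing |x|^p by a polygon of slopes dpow_i with nodes
   b_i >= -1, and estimating the integral of (phi - l - b)^+ over U l from below
   by |U (l + b + 1)|, this forces
   e^p >= 1 - p + (1 - small) sum_i (dpow_(i+1) - dpow_i) exp (- (b_(i+1) + 1)),
   whose right-hand side is a Riemann-Stieltjes sum for J.  Hence M is bounded if
   e^p < J. *)

(** * Convexity of |x|^p: tangents and tangent polygons *)

Section ConvexPower.
Context {R : realType}.
Implicit Types (p x y u h : R).

(** The derivative of |x|^p for [1 < p], in one formula for both signs; see
    [is_derive_norm_powR]. *)
Definition dpow p x : R := p * Num.sg x * `|x| `^ (p - 1).

(** Young's inequality for |x| and |y|^(p-1), with the exponents p and p/(p-1). No differentiation
    is involved, so the derivative can later be deduced from this bound. *)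
Lemma pow_tangent p x y : 1 < p ->
  `|y| `^ p + dpow p y * (x - y) <= `|x| `^ p.
Proof.
move=> p1; have p0 : 0 < p by lra.
have pV : p^-1 * p = 1 by rewrite mulVf// gt_eqF.
pose q := p / (p - 1).
have q0 : 0 < q by rewrite divr_gt0// subr_gt0.
have qV : q^-1 = (p - 1) / p by rewrite /q invf_div.
have pq : p^-1 + q^-1 = 1 by rewrite qV; lra.
have := @conjugate_powR R `|x| (`|y| `^ (p - 1)) p q (normr_ge0 _)
  (powR_ge0 _ _) p0 q0 pq.
have pqE : (p - 1) * q = p by rewrite /q mulrC divfK// gt_eqF// subr_gt0.
rewrite -powRrM pqE qV => young.
have ypE : `|y| * `|y| `^ (p - 1) = `|y| `^ p by rewrite mulr_powRB1.
have sx : Num.sg y * x <= `|x|.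
  apply: (le_trans (ler_norm _)); rewrite normrM.
  by rewrite ler_piMl// normr_sg; case: (_ != _).
have sy : Num.sg y * y = `|y| by rewrite normrEsg.
have -> : dpow p y * (x - y) =
    p * `|y| `^ (p - 1) * (Num.sg y * x) - p * `|y| `^ p.
  by rewrite -ypE -[X in p * (X * _)]sy /dpow; clear; lra.
have h1 : p * `|y| `^ (p - 1) * (Num.sg y * x) <= p * `|y| `^ (p - 1) * `|x|.
  by rewrite ler_wpM2l// mulr_ge0 ?powR_ge0// ltW.
have := ler_wpM2l (ltW p0) young.
have -> : p * (`|x| `^ p / p + `|y| `^ p * ((p - 1) / p)) =
    (`|x| `^ p + (p - 1) * `|y| `^ p) * (p^-1 * p) by clear; lra.
rewrite pV mulr1 => h2.
by lra.
Qed.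

(** The sum of the tangent inequalities at [x] and at [y]. *)
Lemma le_dpow p x y : 1 < p -> x <= y -> dpow p x <= dpow p y.
Proof.
rewrite le_eqVlt => p1 /predU1P[->//|xy].
have := pow_tangent x y p1; have := pow_tangent y x p1 => h1 h2.
rewrite -(@ler_pM2r _ (y - x)) ?subr_gt0//; lra.
Qed.

Lemma dpowN1 p : dpow p (-1) = - p.
Proof. by rewrite /dpow sgrN1 normrN1 powR1; lra. Qed.

(* The polygon whose slope is [psi (b i)] on [[b i, b i.+1]] lies below [Psi]. *)
Lemma polygon_le (Psi psi : R -> R) (b : nat -> R) n u :
  (forall x y, Psi y + psi y * (x - y) <= Psi x) ->
  (forall i, b i <= b i.+1) ->
  Psi (b 0%N) + psi (b 0%N) * (u - b 0%N) +
  \sum_(i < n) (psi (b i.+1) - psi (b i)) * Num.max 0 (u - b i.+1) <= Psi u.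
Proof.
move=> tangent bS.
pose l k := Psi (b 0%N) + psi (b 0%N) * (u - b 0%N) +
  \sum_(i < k) (psi (b i.+1) - psi (b i)) * Num.max 0 (u - b i.+1).
(* The induction carries a second bound: to the right of the last node, the partial polygon stays
   below the tangent at that node. *)
suff [] : l n <= Psi u /\
    (b n <= u -> l n <= Psi (b n) + psi (b n) * (u - b n)) by [].
elim: n => [|n [IH1 IH2]]; first by rewrite /l big_ord0 addr0.
have lS : l n.+1 =
    l n + (psi (b n.+1) - psi (b n)) * Num.max 0 (u - b n.+1).
  by rewrite /l big_ord_recr/= addrA.
suff H : b n.+1 <= u ->
    l n.+1 <= Psi (b n.+1) + psi (b n.+1) * (u - b n.+1).
  split=> //; have [/H/le_trans|ub] := leP (b n.+1) u; first exact.
  rewrite lS (_ : Num.max 0 _ = 0) ?mulr0 ?addr0//.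
  by apply/max_idPl; rewrite subr_le0 ltW.
move=> bu; rewrite lS (_ : Num.max 0 _ = u - b n.+1); last first.
  by apply/max_idPr; rewrite subr_ge0.
have := IH2 (le_trans (bS n) bu); have := tangent (b n.+1) (b n); lra.
Qed.

End ConvexPower.

(** * A rising sun lemma for continuous functions *)

Section RisingSun.
Context {R : realType}.
Implicit Types (G : R -> R) (a b c d : R).

(* The complement in [[c, d]] consists of the points at which [G] is
   nonpositive and from which [G] never rises again. *)
Definition rising_sun G c d : set R :=
  [set x | c < x < d /\ (0 < G x \/ exists2 y, x < y <= d & G x < G y)].

Lemma rising_sun_open G c d : {in `]c, d[, continuous G} ->
  open (rising_sun G c d).
Proof.
move=> cG; rewrite openE => x -[xcd xG].
have cGx : {for x, continuous G} by apply: cG; rewrite in_itv.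
have nx : \forall z \near x, c < z < d.
  have /= := @near_in_itvoo R c d x; rewrite in_itv/= => /(_ xcd).
  by apply: filterS => z; rewrite in_itv.
case: xG => [Gx0|[y /andP[xy yd] Gxy]].
- have Gz : \forall z \near x, 0 < G z by exact: (cvgr_gt _ cGx).
  by rewrite /interior; near=> z; split; [near: z|left; near: z].
- have Gz : \forall z \near x, G z < G y by exact: (cvgr_lt _ cGx).
  have zy : \forall z \near x, z < y by exact: lt_nbhsl.
  rewrite /interior; near=> z; split; first by near: z.
  by right; exists y; [rewrite yd andbT; near: z|near: z].
Unshelve. all: by end_near. Qed.

(** As [a] and [b] are outside the set, [G b <= G a <= 0] and [G] is at most [G b] to the right of
    [b]. If [G b < G a], let [s] be the last point of [[a, b]] at which [G] is at least the midpoint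
    [l] of the two values: it is interior, hence in the set, yet [G s = l <= 0] and nothing to its
    right exceeds [l]. *)
Lemma rising_sun_component G c d a b :
  {within `[c, d], continuous G} -> G c = 0 -> G d <= 0 ->
  c <= a -> a < b -> b <= d ->
  `]a, b[ `<=` rising_sun G c d -> ~ rising_sun G c d a ->
  ~ rising_sun G c d b -> G a = G b.
Proof.
move=> cG Gc Gd ca ab bd abU aU bU.
have Gb0 : G b <= 0.
  rewrite leNgt; apply/negP => Gb.
  move: bd; rewrite le_eqVlt => /predU1P[bd|bd]; first by move: Gb; rewrite bd; lra.
  by apply: bU; split; [lra|left].
have Gby y : b <= y <= d -> G y <= G b.
  move=> /andP[]; rewrite le_eqVlt => /predU1P[->//|byy yd].
  rewrite leNgt; apply/negP => Gby; apply: bU; split; first lra.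
  by right; exists y => //; rewrite byy.
have [Ga0 Gba] : G a <= 0 /\ G b <= G a.
  move: ca; rewrite le_eqVlt => /predU1P[<-|ca]; first by rewrite Gc.
  have acd : c < a < d by lra.
  split; rewrite leNgt; apply/negP => H; apply: aU.
    by split=> //; left.
  by split=> //; right; exists b => //; rewrite ab.
apply/eqP; rewrite eq_le Gba andbT leNgt; apply/negP => GbGa.
pose l := (G a + G b) / 2.
pose S := [set x | a <= x <= b /\ l <= G x].
have Sa : S a by split; rewrite /l; lra.
have Sb : ubound S b by move=> x [/andP[]].
have hS : has_sup S by split; [exists a|exists b].
pose s := sup S.
have Ss x : S x -> x <= s by move=> Sx; apply: ub_le_sup => //; exists b.
have sb : s <= b by exact: (ge_sup (ex_intro _ a Sa) Sb).
have sa : a <= s by apply: Ss.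
have Gs (e : R) : 0 < e -> exists2 r : R, 0 < r &
    forall x, a <= x <= b -> `|s - x| < r -> `|G s - G x| < e.
  move=> e0; have /subspace_continuousP/(_ s) := cG.
  rewrite /= in_itv/= => /(_ ltac:(lra))/cvgrPdist_lt/(_ e e0).
  move=> [r /= r0 rG]; exists r => // x xab sx; apply: rG => //=.
  by rewrite in_itv/=; lra.
have Gsl : G s = l.
  apply/eqP; rewrite eq_le; apply/andP; split; rewrite leNgt; apply/negP => H.
  - have sb' : s < b.
      rewrite lt_neqAle sb andbT; apply: contraPneq H => ->; rewrite /l; lra.
    have [r r0 rG] := Gs (G s - l) ltac:(lra).
    pose x := s + Num.min (r / 2) (b - s).
    have xr : s < x <= b /\ x < s + r.
      by rewrite /x; have [?|?] := leP (r / 2) (b - s); lra.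
    have := rG x ltac:(lra) ltac:(rewrite ler0_norm; lra).
    move=> /ltr_normlP[_ Gx].
    have : S x by split; lra.
    by move=> /Ss; lra.
  - have [r r0 rG] := Gs (l - G s) ltac:(lra).
    have [x [xab lx] xs] := sup_adherent r0 hS.
    have xs' : x <= s by apply: Ss.
    have := rG x xab ltac:(rewrite ger0_norm; rewrite -/s in xs; lra).
    by move=> /ltr_normlP[Gx _]; lra.
have as_ : a < s.
  by rewrite lt_neqAle sa andbT; apply: contraPneq Gsl => <-; rewrite /l; lra.
have sb' : s < b.
  by rewrite lt_neqAle sb andbT; apply: contraPneq Gsl => ->; rewrite /l; lra.
have /abU[_ [|[y /andP[sy yd]]]] : s \in `]a, b[ by rewrite in_itv/=; lra.
  by rewrite Gsl /l; lra.
rewrite Gsl; have [yb ly|by_] := leP y b.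
  have : S y by split; lra.
  by move=> /Ss; lra.
by have := Gby y ltac:(lra); rewrite /l; lra.
Qed.

End RisingSun.

(** * Integrability and integrals of real-valued functions *)

Section RealIntegrable.
Context {disp : measure_display} {T : measurableType disp} {R : realType}.
Variable mu : {measure set T -> \bar R}.
Implicit Types (f g : T -> R) (A B : set T) (k l p : R).

Lemma integrableRD A f g : measurable A -> mu.-integrable A (EFin \o f) ->
  mu.-integrable A (EFin \o g) ->
  mu.-integrable A (EFin \o (fun x => f x + g x)).
Proof. by move=> mA fi gi; have := integrableD mA fi gi. Qed.

Lemma integrableRZ A k f : measurable A -> mu.-integrable A (EFin \o f) ->
  mu.-integrable A (EFin \o (fun x => k * f x)).
Proof. by move=> mA fi; have := integrableZl mA k fi. Qed.

Lemma integrableRcst A k : measurable A -> (mu A < +oo)%E ->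
  mu.-integrable A (EFin \o (fun=> k)).
Proof.
move=> mA Aoo; apply: measurable_bounded_integrable => //.
by exists `|k|; split => // r lr t _ /=; exact: ltW.
Qed.

Lemma integrableRB A f g : measurable A -> mu.-integrable A (EFin \o f) ->
  mu.-integrable A (EFin \o g) ->
  mu.-integrable A (EFin \o (fun x => f x - g x)).
Proof. by move=> mA fi gi; have := integrableB mA fi gi. Qed.

Lemma integrableBcst A f l : measurable A -> (mu A < +oo)%E ->
  mu.-integrable A (EFin \o f) -> mu.-integrable A (EFin \o (fun t => f t - l)).
Proof. by move=> mA Aoo fi; apply: integrableRB => //; exact: integrableRcst. Qed.

Lemma le_integrableR A f g : measurable A -> measurable_fun A f ->
  (forall x, A x -> `|f x| <= g x) -> mu.-integrable A (EFin \o g) ->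
  mu.-integrable A (EFin \o f).
Proof.
move=> mA mf fg gi; apply: (le_integrable mA _ _ gi).
  exact/measurable_EFinP.
by move=> x Ax /=; rewrite lee_fin (le_trans (fg _ Ax))// ler_norm.
Qed.

Lemma integrable_measurableR A f : mu.-integrable A (EFin \o f) ->
  measurable_fun A f.
Proof. by move=> /integrableP[/measurable_EFinP]. Qed.

Lemma integrable_max0 A f : measurable A -> mu.-integrable A (EFin \o f) ->
  mu.-integrable A (EFin \o (fun x => Num.max 0 (f x))).
Proof.
move=> mA fi.
have : mu.-integrable A (EFin \o (fun x => `|f x|)).
  by have := integrable_norm fi.
apply: le_integrableR => //.
  apply: measurable_maxr => //; exact: integrable_measurableR.
by move=> x _; rewrite ger0_norm ?le_max ?lexx// ge_max normr_ge0 ler_norm.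
Qed.

Lemma EFin_Rintegral A g : measurable A -> mu.-integrable A (EFin \o g) ->
  (\int[mu]_(x in A) g x)%:E = (\int[mu]_(x in A) (g x)%:E)%E.
Proof. by move=> mA ig; rewrite /Rintegral fineK//; exact: integrable_fin_num. Qed.

Lemma subset_Rintegral A B f : measurable A -> measurable B ->
  mu.-integrable B (EFin \o f) -> (forall x, B x -> 0 <= f x) -> A `<=` B ->
  \int[mu]_(x in A) f x <= \int[mu]_(x in B) f x.
Proof.
move=> mA mB fi f0 AB; rewrite -lee_fin !EFin_Rintegral//; last first.
  exact: integrableS fi.
apply: ge0_subset_integral => //.
exact/measurable_EFinP/integrable_measurableR.
Qed.

Lemma integrable_sumR A n (F : nat -> T -> R) : measurable A ->
  (forall i, mu.-integrable A (EFin \o F i)) ->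
  mu.-integrable A (EFin \o (fun x => \sum_(i < n) F i x)).
Proof.
move=> mA Fi; have -> : EFin \o (fun x => \sum_(i < n) F i x) =
    (fun x => \sum_(i < n) (EFin \o F i) x)%E.
  by apply/funext => x /=; rewrite sumEFin.
by apply: integrable_sum.
Qed.

Lemma Rintegral_sum A n (F : nat -> T -> R) : measurable A ->
  (forall i, mu.-integrable A (EFin \o F i)) ->
  \int[mu]_(x in A) (\sum_(i < n) F i x) = \sum_(i < n) \int[mu]_(x in A) F i x.
Proof.
move=> mA Fi; elim: n => [|n IH].
  under eq_Rintegral do rewrite big_ord0.
  by rewrite big_ord0 Rintegral_cst// mul0r.
under eq_Rintegral do rewrite big_ord_recr/=.
by rewrite RintegralD// ?big_ord_recr/= ?IH//; exact: integrable_sumR.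
Qed.

Lemma measurable_pow_norm A p k f : measurable_fun A f ->
  measurable_fun A (fun x => `|f x - k| `^ p).
Proof.
move=> mf; apply: (measurableT_comp (measurable_powR _)).
apply: measurableT_comp => //; exact: measurable_funB.
Qed.

(** Domination: |f - l| is at most twice the larger of |f - k| and |k - l|, and the p-th power of a
    maximum is at most the sum of the p-th powers. *)
Lemma integrable_pow_shift A p k l f : 0 <= p -> measurable A ->
  (mu A < +oo)%E -> measurable_fun A f ->
  mu.-integrable A (EFin \o (fun x => `|f x - k| `^ p)) ->
  mu.-integrable A (EFin \o (fun x => `|f x - l| `^ p)).
Proof.
move=> p0 mA Aoo mf fi.
have : mu.-integrable A (EFin \o (fun x =>
    2 `^ p * (`|f x - k| `^ p + `|k - l| `^ p))).
  by apply: integrableRZ => //; apply: integrableRD => //; exact: integrableRcst.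
apply: le_integrableR => //; first exact: measurable_pow_norm.
move=> x _; rewrite ger0_norm ?powR_ge0//.
pose M := Num.max `|f x - k| `|k - l|.
have M0 : 0 <= M by rewrite le_max normr_ge0.
have h : `|f x - l| <= 2 * M.
  have := ler_normD (f x - k) (k - l); rewrite subrKA.
  have : `|f x - k| <= M by rewrite le_max lexx.
  have : `|k - l| <= M by rewrite le_max lexx orbT.
  lra.
apply: (@le_trans _ _ ((2 * M) `^ p)).
  by rewrite ge0_ler_powR// ?nnegrE// mulr_ge0.
rewrite powRM// ler_wpM2l ?powR_ge0// /M.
by have [_|_] := leP `|f x - k| `|k - l|; rewrite ?lerDl ?lerDr powR_ge0.
Qed.

End RealIntegrable.

(** * The open sets given by the rising sun lemma at each level *)

Section Shade.
Context {R : realType}.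
Local Notation mu := (@lebesgue_measure R).
Implicit Types (f g : R -> R) (a b c d l : R) (U A : set R).

(** The open set is a countable disjoint union of open intervals, and the integral is countably
    additive, so an estimate on each component suffices. *)
Lemma Rintegral_open_le0 U c d g : open U -> U `<=` `[c, d] ->
  mu.-integrable U (EFin \o g) ->
  (forall a b, c <= a -> a < b -> b <= d ->
    `]a, b[ `<=` U -> ~ U a -> ~ U b -> \int[mu]_(x in `]a, b[) g x <= 0) ->
  \int[mu]_(x in U) g x <= 0.
Proof.
move=> oU Ucd ig H.
pose I := open_disjoint_itv oU.
have UI : U = \bigcup_q I q by exact: open_disjoint_itv_bigcup.
have oI q : open (I q) by exact: open_disjoint_itv_open.
have tI : trivIset setT I by exact: open_disjoint_itv_trivIset.
have IU q : I q `<=` U by rewrite UI; exact: bigcup_sup.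
have mI q : measurable (I q) by exact: open_measurable.
have igI q : mu.-integrable (I q) (EFin \o g).
  by apply: integrableS ig => //; exact: open_measurable.
suff Hq q : (\int[mu]_(x in I q) (g x)%:E <= 0)%E.
  rewrite /Rintegral -[leRHS]/(fine 0) fine_le ?integrable_fin_num//.
    exact: open_measurable.
  rewrite UI integral_bigcup//; last by rewrite -UI.
  by apply: npeseries_le0.
have [->|/set0P[x Ix]] := eqVneq (I q) set0; first by rewrite integral_set0.
have lbI : has_lbound (I q).
  by exists c => z /IU/Ucd; rewrite /= in_itv/= => /andP[].
have ubI : has_ubound (I q).
  by exists d => z /IU/Ucd; rewrite /= in_itv/= => /andP[].
have IE : I q = `]inf (I q), sup (I q)[%classic.
  have iI : is_interval (I q) by exact: open_disjoint_itv_is_interval.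
  have := interval_bounded_interior iI lbI ubI.
  by rewrite (interior_id (I q)).1 // set_itvoo.
set a := inf (I q) in IE *; set b := sup (I q) in IE *.
have /andP[ax xb] : a < x < b by move: Ix; rewrite IE /= in_itv.
(* A point of [U] adherent to a component belongs to it, because the components are open and
   disjoint. Hence the endpoints of a component are not in [U]. *)
have notin z : U z -> (forall r, 0 < r -> exists2 y, I q y & `|z - y| < r) -> I q z.
  rewrite {1}UI => -[k _ Ikz] zI.
  have [r /= r0 rI] := oI k z Ikz.
  have [y Iy zy] := zI r r0.
  have Iky : I k y by apply: rI.
  suff -> : q = k by [].
  by apply: (tI q k) => //; exists y.
suff : \int[mu]_(x in I q) g x <= 0.
  by rewrite -lee_fin EFin_Rintegral; [|exact: mI|exact: igI].
rewrite IE; apply: H.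
- by apply: lb_le_inf; [exists x|move=> z /IU/Ucd; rewrite /= in_itv/= => /andP[]].
- lra.
- by apply: ge_sup; [exists x|move=> z /IU/Ucd; rewrite /= in_itv/= => /andP[]].
- by rewrite -IE.
- move=> /notin Ia; have : I q a.
    apply: Ia => r r0; exists (a + Num.min (r / 2) ((x - a) / 2)).
      by rewrite IE /= in_itv/=; have [?|?] := leP (r / 2) ((x - a) / 2); lra.
    by rewrite ler0_norm; have [?|?] := leP (r / 2) ((x - a) / 2); lra.
  by rewrite IE /= in_itv/= ltxx.
- move=> /notin Ib; have : I q b.
    apply: Ib => r r0; exists (b - Num.min (r / 2) ((b - x) / 2)).
      by rewrite IE /= in_itv/=; have [?|?] := leP (r / 2) ((b - x) / 2); lra.
    by rewrite ger0_norm; have [?|?] := leP (r / 2) ((b - x) / 2); lra.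
  by rewrite IE /= in_itv/= ltxx andbF.
Qed.

(* In terms of averages: the points [x] such that [f] has average [> l] on
   [[c, x]] or on some [[x, y]]. *)
Definition shade f c d l : set R :=
  rising_sun (fun x => \int[mu]_(t in `[c, x]) (f t - l)) c d.

Lemma mu_itvcc_lty c d : (mu `[c, d] < +oo)%E.
Proof. by rewrite lebesgue_measure_itv /=; case: ifP; rewrite ltry. Qed.

Section Fixed.
Variables (f : R -> R) (c d : R).
Hypotheses (cd : c < d) (fi : mu.-integrable `[c, d] (EFin \o f)).

Let fil l : mu.-integrable `[c, d] (EFin \o (fun t => f t - l)).
Proof. by apply: integrableBcst => //; exact: mu_itvcc_lty. Qed.

Let cG l :
  {within `[c, d], continuous (fun x => \int[mu]_(t in `[c, x]) (f t - l))}.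
Proof. exact: (parameterized_integral_continuous (ltW cd) (fil l)). Qed.

Lemma shade_sub l : shade f c d l `<=` `]c, d[.
Proof. by move=> x [xcd _]; rewrite /= in_itv. Qed.

Lemma shade_open l : open (shade f c d l).
Proof.
apply: rising_sun_open.
by have [] := (continuous_within_itvP _ cd).1 (@cG l).
Qed.

Lemma shade_subcc l : shade f c d l `<=` `[c, d].
Proof. by move=> x /shade_sub; apply: subset_itv_oo_cc. Qed.

Lemma shade_measurable l : measurable (shade f c d l).
Proof. by apply: open_measurable; exact: shade_open. Qed.

Let GB l x y : c <= x <= y -> y <= d ->
  \int[mu]_(t in `[c, y]) (f t - l) - \int[mu]_(t in `[c, x]) (f t - l) =
  \int[mu]_(t in `]x, y]) (f t - l).
Proof.
move=> /andP[cx xy] yd; rewrite Rintegral_itvB ?bnd_simp//.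
by apply: integrableS (fil l) => //; apply: subset_itvl.
Qed.

(** Membership is witnessed by a positive integral of [f - k] over some [[c, x]] or []x, y]], and
    lowering the level only increases that integral. *)
Lemma shadeS l k : l <= k -> shade f c d k `<=` shade f c d l.
Proof.
move=> lk x [xcd xU]; split=> //.
have le A : measurable A -> A `<=` `[c, d] ->
    \int[mu]_(t in A) (f t - k) <= \int[mu]_(t in A) (f t - l).
  move=> mA Acd; apply: le_Rintegral => //; last by move=> t _; lra.
    by apply: integrableS (fil k).
  by apply: integrableS (fil l).
case: xU => [Gx|[y /andP[xy yd] Gxy]]; [left|right].
  by apply: lt_le_trans Gx _; apply: le => //; apply: subset_itvl; rewrite bnd_simp; lra.
exists y; first by rewrite xy.
rewrite -subr_gt0 GB//; last by lra.
apply: lt_le_trans (le _ _ _) => //.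
  by rewrite -GB ?subr_gt0//; lra.
move=> z /=; rewrite !in_itv/=; lra.
Qed.

(** The hypothesis on [[c, d]] says that the primitive of [f - l] is nonpositive at [d], as
    [rising_sun_component] requires; equal values of the primitive at [a] and [b] make the integral
    between them vanish. *)
Lemma shade_component l a b : \int[mu]_(t in `[c, d]) (f t - l) <= 0 ->
  c <= a -> a < b -> b <= d -> `]a, b[ `<=` shade f c d l ->
  ~ shade f c d l a -> ~ shade f c d l b ->
  \int[mu]_(t in `[a, b]) (f t - l) = 0.
Proof.
move=> Gd ca ab bd abU aU bU.
have : \int[mu]_(t in `[c, a]) (f t - l) = \int[mu]_(t in `[c, b]) (f t - l).
  apply: (rising_sun_component (@cG l)) aU bU => //.
  by rewrite set_itv1 Rintegral_set1.
move=> /eqP; rewrite eq_sym -subr_eq0 GB//; last by lra.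
move=> /eqP <-; rewrite Rintegral_itv_obnd_cbnd//.
by apply: integrableS (fil l) => // z /=; rewrite !in_itv/=; lra.
Qed.

(** At a Lebesgue point [x] other than [c] and [d], the primitive of [f - l] has derivative
    [f x - l]. If this is positive, the primitive rises just after [x], which puts [x] in the shade.
    The function is extended by 0 outside [[c, d]] to be locally integrable on the line. *)
Lemma shade_compl_le l : {ae mu, forall x, `[c, d]%classic x ->
  ~ shade f c d l x -> f x <= l}.
Proof.
pose g t := f t - l.
have loc : locally_integrable setT (g \_ `[c, d]).
  by apply: integrable_locally => //; exact: fil.
have nc : mu.-negligible [set c; d].
  apply/negligibleP => //.
    by apply: measurableU; exact: measurable_set1.
  apply/eqP; rewrite eq_le measure_ge0 andbT.
  rewrite (le_trans (measureU2 _ _ _))//=; try exact: measurable_set1.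
  by rewrite !lebesgue_measure_set1 adde0.
have nae : {ae mu, forall x, x != c /\ x != d}.
  apply: negligibleS nc => x /= H.
  by apply: contrapT => H'; apply: H; split; apply: contra_notN H' => /eqP ->;
    [left|right].
have FF := ae_filter_ringOfSetsType mu.
apply: filterS2 nae (lebesgue_differentiation loc) => x [xc xd] lx.
rewrite /= in_itv/= => xcd xU.
have {xc xd xcd} /andP[cx xd] : c < x < d.
  by move: xcd; rewrite !le_eqVlt eq_sym (negPf xc) (negPf xd).
have fi' : mu.-integrable `[c, d] (EFin \o (g \_ `[c, d])).
  by rewrite -restrict_EFin; apply/integrable_restrict => //=; rewrite setIid; exact: fil.
pose G y := \int[mu]_(t in `[c, y]) (f t - l).
pose F y := \int[mu]_(t in `[c, y]) ((g \_ `[c, d]) t).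
have FG y : y <= d -> F y = G y.
  move=> yd; apply: eq_Rintegral => t; rewrite inE /= in_itv/= => /andP[ct ty].
  by rewrite patchE ifT// inE /= in_itv/= ct (le_trans ty).
have cx' : (BLeft c < BRight x)%E by rewrite lte_fin.
have [dF F'] := FTC1_lebesgue_pt xd fi' cx' lx.
have {F'} F' : derive1 F x = f x - l.
  by rewrite [LHS]F' patchE ifT// inE /= in_itv/=; lra.
have cv : h^-1 *: (F (h *: 1 + x) - F x) @[h --> 0^'] --> f x - l.
  by rewrite -F' derive1E; exact: dF.
rewrite leNgt; apply/negP => lfx.
have fx0 : 0 < f x - l by lra.
have /= H := cvgr_gt _ (cvg_dnbhs_at_right cv) _ fx0.
near (0%R:R)^'+ => h.
have h0 : 0 < h by near: h; exact: nbhs_right_gt.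
have hd : h < d - x by near: h; apply: nbhs_right_lt; rewrite subr_gt0.
have : 0 < h^-1 *: (F (h *: 1 + x) - F x) by near: h; exact: H.
rewrite /GRing.scale/= mulr1 pmulr_rgt0 ?invr_gt0// FG; last by lra.
rewrite FG; last by lra.
rewrite subr_gt0 => Gh; apply: xU; split; first by lra.
by right; exists (h + x); [lra|].
Unshelve. all: by end_near. Qed.

End Fixed.
End Shade.

(** * Integrals over the shade under a bound on the oscillation *)

Section ShadeIntegrals.
Context {R : realType}.
Local Notation mu := (@lebesgue_measure R).
Variables (p K c d : R) (f : R -> R).
Hypotheses (p1 : 1 < p) (cd : c < d).
Hypothesis fi : mu.-integrable `[c, d] (EFin \o f).
Local Notation m := (average c d f).
Hypothesis fpi : mu.-integrable `[c, d] (EFin \o (fun x => `|f x - m| `^ p)).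
Hypothesis osc : forall a b, c <= a -> a < b -> b <= d ->
  \int[mu]_(x in `[a, b]) (`|f x - average a b f| `^ p) <= K * (b - a).

Local Notation U := (shade f c d).
Local Notation u l := (fine (mu (U l))).
Implicit Types (a b k l : R) (A : set R).

Let mU l : measurable (U l). Proof. exact: shade_measurable. Qed.
Local Hint Extern 0 (measurable (shade _ _ _ _)) => exact: mU : core.
Let Ucc l : U l `<=` `[c, d]. Proof. exact: shade_subcc. Qed.

Let muA A : measurable A -> A `<=` `[c, d] -> (mu A < +oo)%E.
Proof.
move=> mA Acd; apply: le_lt_trans (mu_itvcc_lty c d).
by apply: le_measure; rewrite ?inE.
Qed.

Let fil A l : measurable A -> A `<=` `[c, d] ->
  mu.-integrable A (EFin \o (fun t => f t - l)).
Proof.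
by move=> mA Acd; apply: integrableBcst (integrableS _ _ _ fi) => //; exact: muA.
Qed.

Let fpil A l : measurable A -> A `<=` `[c, d] ->
  mu.-integrable A (EFin \o (fun t => `|f t - l| `^ p)).
Proof.
move=> mA Acd.
suff : mu.-integrable `[c, d] (EFin \o (fun t => `|f t - l| `^ p)).
  by move=> H; apply: integrableS H.
apply: integrable_pow_shift fpi => //; first by rewrite ltW// (lt_trans ltr01).
  exact: mu_itvcc_lty.
apply: integrable_measurableR fi.
Qed.

Lemma averageE a b : c <= a -> a < b -> b <= d ->
  average a b f = (b - a)^-1 * \int[mu]_(x in `[a, b]) f x.
Proof.
move=> ca ab bd; rewrite /average /eaverage fineM//.
apply: integrable_fin_num => //; apply: integrableS fi => //.
by move=> x /=; rewrite !in_itv/=; lra.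
Qed.

Let RintB A l : measurable A -> A `<=` `[c, d] ->
  \int[mu]_(x in A) (f x - l) = \int[mu]_(x in A) f x - l * fine (mu A).
Proof.
move=> mA Acd; rewrite RintegralB//; first by rewrite Rintegral_cst.
  exact: integrableS fi.
by apply: integrableRcst => //; exact: muA.
Qed.

Let mucc a b : a < b -> fine (mu `[a, b]) = b - a.
Proof. by move=> ab; rewrite lebesgue_measure_itv/= lte_fin ab. Qed.

Lemma average_le l : m <= l -> \int[mu]_(t in `[c, d]) (f t - l) <= 0.
Proof.
move=> ml; rewrite RintB// mucc// subr_le0 -ler_pdivrMr ?subr_gt0//.
by rewrite mulrC -averageE.
Qed.

Let component_cc l a b : m <= l -> c <= a -> a < b -> b <= d ->
  `]a, b[ `<=` U l -> ~ U l a -> ~ U l b -> 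
  \int[mu]_(t in `[a, b]) (f t - l) = 0.
Proof. by move=> /average_le; apply: shade_component. Qed.

Let oo_cc a b g : mu.-integrable `[a, b] (EFin \o g) ->
  \int[mu]_(t in `]a, b[) g t = \int[mu]_(t in `[a, b]) g t.
Proof.
move=> gi; rewrite Rintegral_itv_bndo_bndc.
  rewrite Rintegral_itv_obnd_cbnd//.
  by apply: integrableS gi => //; apply: subset_itv_oc_cc.
by apply: integrableS gi => //; apply: subset_itv_oo_cc.
Qed.

Let sub_cc a b : c <= a -> b <= d -> `[a, b] `<=` `[c, d].
Proof. by move=> ca bd x /=; rewrite !in_itv/=; lra. Qed.

(** The integral vanishes on each component. As [Rintegral_open_le0] yields upper bounds only, it is
    applied to [f - l] and to its opposite. *)
Lemma shade_average l : m <= l -> \int[mu]_(x in U l) (f x - l) = 0.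
Proof.
move=> ml; apply/eqP; rewrite eq_le; apply/andP; split.
  apply: (@Rintegral_open_le0 _ _ c d) => //; first exact: shade_open.
    exact: fil.
  move=> a b ca ab bd abU aU bU; rewrite oo_cc; first by rewrite component_cc.
  by apply: fil => //; exact: sub_cc.
rewrite -oppr_le0 -mulN1r -RintegralZl//; last exact: fil.
apply: (@Rintegral_open_le0 _ _ c d) => //; first exact: shade_open.
  by apply: integrableRZ => //; exact: fil.
move=> a b ca ab bd abU aU bU.
have sab := sub_cc ca bd.
rewrite oo_cc; last by apply: integrableRZ => //; exact: fil.
by rewrite RintegralZl// ?component_cc ?mulr0//; exact: fil.
Qed.

(** On each component the average of [f] is exactly [l], so [osc] applies there and the bounds add
    up. *)
Lemma shade_power l : m <= l ->
  \int[mu]_(x in U l) (`|f x - l| `^ p) <= K * u l.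
Proof.
move=> ml; rewrite -subr_le0 -Rintegral_cst// -RintegralB//; last 2 first.
  exact: fpil.
  by apply: integrableRcst => //; exact: muA.
have ig A : measurable A -> A `<=` `[c, d] ->
    mu.-integrable A (EFin \o (fun x => `|f x - l| `^ p - K)).
  by move=> mA Acd; apply: integrableBcst; [|exact: muA|exact: fpil].
apply: (@Rintegral_open_le0 _ _ c d) => //; [exact: shade_open|exact: ig|].
move=> a b ca ab bd abU aU bU.
have sab := sub_cc ca bd.
rewrite oo_cc; last exact: ig.
have avg : average a b f = l.
  have := component_cc ml ca ab bd abU aU bU.
  rewrite RintB// mucc// averageE// => /subr0_eq ->.
  by rewrite mulrC mulfK// gt_eqF// subr_gt0.
rewrite RintegralB//; last 2 first.
  exact: fpil.
  by apply: integrableRcst => //; exact: muA.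
by rewrite Rintegral_cst// mucc// subr_le0 -{1}avg osc.
Qed.

(* The tangent polygon with nodes [-1 + i h], integrated over [U l]; the part
   above the node [b] is controlled by the smaller set [U (l + b + 1)]. *)
Lemma shade_power_ge l h n : m <= l -> 0 <= h ->
  u l * (1 - p) + \sum_(i < n)
    (dpow p (i.+1%:R * h - 1) - dpow p (i%:R * h - 1)) * u (l + i.+1%:R * h)
  <= \int[mu]_(x in U l) (`|f x - l| `^ p).
Proof.
move=> ml h0.
pose b i : R := i%:R * h - 1.
have bS i : b i <= b i.+1 by rewrite /b lerD2r ler_wpM2r// ler_nat.
pose Dl i := dpow p (b i.+1) - dpow p (b i).
have Dl0 i : 0 <= Dl i by rewrite subr_ge0 le_dpow.
pose g i x := Dl i * Num.max 0 (f x - l - b i.+1).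
have maxi i : mu.-integrable (U l) (EFin \o (fun x => Num.max 0 (f x - l - b i.+1))).
  apply: integrable_max0 => //; apply: integrableBcst => //; first exact: muA.
  exact: fil.
have gi i : mu.-integrable (U l) (EFin \o g i) by apply: integrableRZ.
(* The tangent to |y|^p at the first node -1, evaluated at [f x - l]; its linear term integrates to
   0 over [U l]. *)
pose aff x := - p * (f x - l) + (1 - p).
have affi : mu.-integrable (U l) (EFin \o aff).
  apply: integrableRD => //; first by apply: integrableRZ => //; exact: fil.
  by apply: integrableRcst => //; exact: muA.
have gsi : mu.-integrable (U l) (EFin \o (fun x => \sum_(i < n) g i x)).
  exact: integrable_sumR.
apply: (@le_trans _ _ (\int[mu]_(x in U l) (aff x + \sum_(i < n) g i x))).
  rewrite RintegralD// Rintegral_sum// RintegralD//; last 2 first.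
    by apply: integrableRZ => //; exact: fil.
    by apply: integrableRcst => //; exact: muA.
  rewrite RintegralZl//; last exact: fil.
  rewrite shade_average// mulr0 add0r Rintegral_cst// mulrC lerD2l.
  apply: ler_sum => i _; rewrite RintegralZl//; apply: (ler_wpM2l (Dl0 i)).
  (* Here [f x - l - b i.+1] equals [(f x - k) + 1], whose integral over [U k] is [u k] by
     [shade_average]. *)
  pose k := l + i.+1%:R * h.
  have lk : l <= k by rewrite /k lerDl mulr_ge0.
  apply: (@le_trans _ _ (\int[mu]_(x in U k) Num.max 0 (f x - l - b i.+1))); last first.
    apply: subset_Rintegral; [by []|by []|exact: maxi| |exact: shadeS].
    by move=> x _; rewrite le_max lexx.
  apply: (@le_trans _ _ (\int[mu]_(x in U k) ((f x - k) + 1))).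
    rewrite RintegralD//; last 2 first.
      exact: fil.
      by apply: integrableRcst => //; exact: muA.
    rewrite shade_average//; last exact: le_trans lk.
    by rewrite add0r Rintegral_cst// mul1r.
  apply: le_Rintegral => //.
  - apply: integrableRD => //; first exact: fil.
    by apply: integrableRcst => //; exact: muA.
  - by apply: integrableS (maxi i) => //; exact: shadeS.
  - move=> x _; rewrite le_max; apply/orP; right; rewrite /k /b; lra.
apply: le_Rintegral => //; [exact: integrableRD|exact: fpil|].
move=> x _.
have := @polygon_le R (fun y => `|y| `^ p) (dpow p) b n (f x - l).
move=> /(_ (fun x y => pow_tangent x y p1) bS).
rewrite /b mul0r sub0r dpowN1 normrN1 powR1 /aff /g /Dl /b; lra.
Qed.

End ShadeIntegrals.

(** The chain of inequalities of [near_max]: [w1] and [w2] stand for the integrals at two levels,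
    [Y] for the bound on their difference, and [X] and [Z] for the bounds obtained from the supremum
    of the ratios. *)
Lemma decay_arith (R : realDomainType) (t dl w1 w2 X Y Z : R) : dl <= 1 ->
  t * X <= (1 - dl) * (1 - dl) * X -> (1 - dl) * X <= w1 -> Y <= dl * w1 ->
  w1 <= w2 + Y -> w2 <= Z -> t * X <= Z.
Proof.
move=> dl1 tX Xw1 Yw1 w12 w2Z.
have : (1 - dl) * ((1 - dl) * X) <= (1 - dl) * w1.
  by rewrite ler_wpM2l// subr_ge0.
lra.
Qed.

(** * The exponential integral under a bound on the oscillation *)

Section ExpBound.
Context {R : realType}.
Local Notation mu := (@lebesgue_measure R).
Variables (p K c d : R) (f : R -> R).
Hypotheses (p1 : 1 < p) (cd : c < d).
Hypothesis fi : mu.-integrable `[c, d] (EFin \o f).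
Local Notation m := (average c d f).
Hypothesis fpi : mu.-integrable `[c, d] (EFin \o (fun x => `|f x - m| `^ p)).
Hypothesis osc : forall a b, c <= a -> a < b -> b <= d ->
  \int[mu]_(x in `[a, b]) (`|f x - average a b f| `^ p) <= K * (b - a).

Local Notation U := (shade f c d).
Local Notation u l := (fine (mu (U l))).
Local Notation w N := (fun x => expR (Num.min (f x) N)).
Local Notation W N l := (\int[mu]_(x in U l) expR (Num.min (f x) N)).
Implicit Types (a b k l N : R) (A : set R).

Let mU l : measurable (U l). Proof. exact: shade_measurable. Qed.
Local Hint Extern 0 (measurable (shade _ _ _ _)) => exact: mU : core.
Let Ucc l : U l `<=` `[c, d]. Proof. exact: shade_subcc. Qed.

Let muA A : measurable A -> A `<=` `[c, d] -> (mu A < +oo)%E.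
Proof.
move=> mA Acd; apply: le_lt_trans (mu_itvcc_lty c d).
by apply: le_measure; rewrite ?inE.
Qed.

Let mw A N : measurable A -> A `<=` `[c, d] -> measurable_fun A (w N).
Proof.
move=> mA Acd; apply: (measurableT_comp (@measurable_expR R)).
apply: measurable_minr => //.
by apply: measurable_funS (integrable_measurableR fi).
Qed.

Let wi A N : measurable A -> A `<=` `[c, d] -> mu.-integrable A (EFin \o w N).
Proof.
move=> mA Acd.
have : mu.-integrable A (EFin \o (fun=> expR N)).
  by apply: integrableRcst => //; exact: muA.
apply: le_integrableR => //; first exact: mw.
by move=> x _; rewrite ger0_norm ?expR_ge0// ler_expR ge_min lexx orbT.
Qed.

(** Off [U k] the integrand is at most [expR k] almost everywhere, by [shade_compl_le]. *)
Let w_le A N k : measurable A -> A `<=` `[c, d] -> A `&` U k = set0 ->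
  \int[mu]_(x in A) w N x <= expR k * fine (mu A).
Proof.
move=> mA Acd AU; rewrite -Rintegral_cst// -lee_fin !EFin_Rintegral//; last first.
- exact: wi.
- by apply: integrableRcst => //; exact: muA.
apply: ae_ge0_le_integral => //.
- by apply/measurable_EFinP; exact: mw.
- apply: (@filterS _ _ (ae_filter_ringOfSetsType mu) _ _ _
    (shade_compl_le fi k)) => x H Ax.
  have fx : f x <= k.
    apply: H; first exact: Acd.
    by move=> Ux; suff : set0 x by []; rewrite -AU.
  by rewrite lee_fin ler_expR ge_min fx.
Qed.

Let WD N l k : l <= k -> W N l <= W N k + expR k * u l.
Proof.
move=> lk; have UU := shadeS fi lk.
have mD : measurable (U l `\` U k) by exact: measurableD.
have Dcc : U l `\` U k `<=` `[c, d] by move=> x [/Ucc].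
rewrite -[X in \int[_]_(x in X) _ <= _](setDUK UU) Rintegral_setU//; last 2 first.
- by rewrite setDUK//; exact: wi.
- by apply/disj_setPS => x [Ux []].
rewrite lerD2l (le_trans (@w_le _ N k mD Dcc _))//.
  by apply/seteqP; split => x // -[[]].
rewrite ler_wpM2l ?expR_ge0//; apply: fine_le.
- by rewrite ge0_fin_numE// muA.
- by rewrite ge0_fin_numE// muA.
- by apply: le_measure; rewrite ?inE//; move=> x [].
Qed.

Let W_le N l : W N l <= expR N * u l.
Proof.
rewrite -Rintegral_cst//; apply: le_Rintegral => //; first exact: wi.
  by apply: integrableRcst => //; exact: muA.
by move=> x _; rewrite ler_expR ge_min lexx orbT.
Qed.

Let u_ge0 l : 0 <= u l. Proof. exact: fine_ge0. Qed.

Let u_le l : u l <= d - c.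
Proof.
have -> : d - c = fine (mu `[c, d]) by rewrite lebesgue_measure_itv/= lte_fin cd.
apply: fine_le; rewrite ?ge0_fin_numE ?muA//.
by apply: le_measure; rewrite ?inE.
Qed.

Let total N : \int[mu]_(x in `[c, d]) w N x <= W N m + expR m * (d - c).
Proof.
have mD : measurable (`[c, d] `\` U m) by exact: measurableD.
have Dcc : `[c, d] `\` U m `<=` `[c, d] by move=> x [].
have UU := @Ucc m.
rewrite -[X in \int[_]_(x in X) _ <= _](setDUK UU) Rintegral_setU//; last 2 first.
- by rewrite setDUK//; exact: wi.
- by apply/disj_setPS => x [Ux []].
rewrite lerD2l (le_trans (@w_le _ N m mD Dcc _))//.
  by apply/seteqP; split => x // -[[]].
rewrite ler_wpM2l ?expR_ge0//.
have -> : d - c = fine (mu `[c, d]) by rewrite lebesgue_measure_itv/= lte_fin cd.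
by apply: fine_le; rewrite ?ge0_fin_numE ?muA//; apply: le_measure; rewrite ?inE.
Qed.

(* At a level [k] nearly maximising [W N k / (u k * expR k)], the measures of
   the sets [U (k + b)] decay essentially no faster than [expR (- b)]. *)
Let near_max N l C h t n : m <= l -> 0 <= h -> 0 < t -> t < 1 -> 0 < C ->
  C * (1 - t) = 2 * expR (n%:R * h) -> C * (u l * expR l) < W N l ->
  exists k, [/\ m <= k, 0 < u k & forall i : 'I_n,
    t * (u k * expR (- (i.+1%:R * h))) <= u (k + i.+1%:R * h)].
Proof.
move=> ml h0 t0 t1 C0 CE Wl.
pose S := [set y | exists k, [/\ m <= k, 0 < u k & y = W N k / (u k * expR k)]].
have ratio k : 0 < u k -> W N k = W N k / (u k * expR k) * (u k * expR k).
  by move=> uk; rewrite divfK// gt_eqF// mulr_gt0 ?expR_gt0.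
have ul : 0 < u l.
  rewrite lt_neqAle u_ge0 andbT; apply: contraTneq Wl => ul0; rewrite -leNgt.
  by have := W_le N l; rewrite -ul0 mul0r !mulr0.
(* The truncation bounds the ratios, so that their supremum exists. This bound depends on [N], but
   only its finiteness matters. *)
have S_ub : ubound S (expR (N - m)).
  move=> _ [k [mk uk ->]].
  rewrite ler_pdivrMr ?mulr_gt0 ?expR_gt0// mulrCA -expRD.
  apply: (le_trans (W_le N k)); rewrite mulrC ler_wpM2l// ler_expR.
  by rewrite -addrA lerDl addrC subr_ge0.
have Sl : S (W N l / (u l * expR l)) by exists l.
have hS : has_sup S by split; [exists (W N l / (u l * expR l))|exists (expR (N - m))].
pose s := sup S.
have Ss y : S y -> y <= s by move=> Sy; apply: ub_le_sup => //; exists (expR (N - m)).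
have Cs : C < s.
  apply: lt_le_trans (Ss _ Sl).
  by rewrite ltr_pdivlMr// mulr_gt0// expR_gt0.
have s0 : 0 < s by apply: lt_trans Cs.
have Ws k : m <= k -> W N k <= s * (u k * expR k).
  move=> mk; have [uk|uk] := ltP 0 (u k).
    rewrite {1}ratio// ler_wpM2r ?mulr_ge0 ?expR_ge0//.
    by apply: Ss; exists k.
  have uk0 : u k = 0 by apply/eqP; rewrite eq_le uk u_ge0.
  by have := W_le N k; rewrite uk0 mul0r !mulr0.
(* The half gives [t <= (1 - dl) * (1 - dl)]: one factor pays for choosing [k] near the supremum,
   the other for absorbing [expR k' * u k] into [W N k], which is possible since
   [dl * C = expR (n%:R * h)]. *)
pose dl := (1 - t) / 2.
have dl0 : 0 < dl by rewrite /dl; lra.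
have dl1 : dl <= 1 by rewrite /dl; lra.
have dl2 : t <= (1 - dl) * (1 - dl).
  by have : 0 <= dl * dl by [rewrite mulr_ge0// ltW]; rewrite /dl; lra.
have dlC : dl * C = expR (n%:R * h) by rewrite /dl; lra.
have [_ [k [mk uk ->]] Wk] : exists2 y, S y & Num.max C (s * (1 - dl)) < y.
  have e0 : 0 < Num.min (s - C) (s * dl) by rewrite lt_min subr_gt0 Cs mulr_gt0.
  have [y Sy ys] := sup_adherent e0 hS.
  exists y => //; rewrite gt_max; apply/andP; split; move: ys; rewrite -/s.
    by have [?|?] := leP (s - C) (s * dl); lra.
  by have [?|?] := leP (s - C) (s * dl); lra.
have [{}Wl Wk2] : C * (u k * expR k) < W N k /\
    s * (1 - dl) * (u k * expR k) < W N k.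
  by move: Wk; rewrite gt_max => /andP[]; rewrite !ltr_pdivlMr ?mulr_gt0 ?expR_gt0.
have decay (i : 'I_n) :
    t * (u k * expR (- (i.+1%:R * h))) <= u (k + i.+1%:R * h).
  set b := i.+1%:R * h; set k' := k + b.
  have b0 : 0 <= b by rewrite mulr_ge0.
  have bn : expR b <= expR (n%:R * h).
    by rewrite ler_expR ler_wpM2r// ler_nat.
  have kk' : k <= k' by rewrite /k' lerDl.
  have h1 : expR k' * u k <= dl * W N k.
    apply: (@le_trans _ _ (dl * (C * (u k * expR k)))); last first.
      by rewrite ler_wpM2l// ltW.
    rewrite mulrA dlC /k' expRD.
    rewrite [expR k * _]mulrC -mulrA [expR k * _]mulrC.
    by rewrite ler_wpM2r// mulr_ge0 ?expR_ge0.
  have h2 := WD N kk'.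
  have h3 := Ws k' (le_trans mk kk').
  have uu : t * (u k * expR k) <= u k' * expR k'.
    rewrite -(ler_pM2l s0).
    have X0 : 0 <= s * (u k * expR k) by rewrite !mulr_ge0 ?expR_ge0// ltW.
    rewrite mulrCA; apply: decay_arith dl1 (ler_wpM2r X0 dl2) _ h1 h2 h3.
    by rewrite mulrA [(1 - dl) * s]mulrC ltW.
  rewrite expRN mulrA ler_pdivrMr ?expR_gt0//.
  rewrite -(ler_pM2r (expR_gt0 k)) -[leRHS]mulrA -expRD [b + k]addrC -/k'.
  by rewrite -mulrA.
by exists k.
Qed.

Section Ratio.
Variables (h t : R) (n : nat).
Hypotheses (h0 : 0 <= h) (t0 : 0 < t) (t1 : t < 1).
Hypothesis Kt : K < 1 - p + t * \sum_(i < n)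
  (dpow p (i.+1%:R * h - 1) - dpow p (i%:R * h - 1)) * expR (- (i.+1%:R * h)).
Local Notation C := (2 * expR (n%:R * h) / (1 - t)).

(** Otherwise [near_max] provides a level [k] with slowly decaying measures; there the lower bound
    [shade_power_ge] and the upper bound [shade_power], divided by [u k], contradict [Kt]. *)
Let W_bound N l : m <= l -> W N l <= C * (u l * expR l).
Proof.
move=> ml; rewrite leNgt; apply/negP => Wl.
have C0 : 0 < C by rewrite divr_gt0 ?mulr_gt0 ?expR_gt0 ?subr_gt0.
have CE : C * (1 - t) = 2 * expR (n%:R * h).
  by rewrite divfK// gt_eqF// subr_gt0.
have [k [mk uk decay]] := near_max ml h0 t0 t1 C0 CE Wl.
have := shade_power_ge p1 cd fi fpi n mk h0.
have := shade_power p1 cd fi fpi osc mk.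
have : u k * (t * \sum_(i < n)
    (dpow p (i.+1%:R * h - 1) - dpow p (i%:R * h - 1)) * expR (- (i.+1%:R * h)))
  <= \sum_(i < n) (dpow p (i.+1%:R * h - 1) - dpow p (i%:R * h - 1)) *
    u (k + i.+1%:R * h).
  rewrite mulrA mulr_sumr; apply: ler_sum => i _.
  apply: le_trans (ler_wpM2l _ (decay i)).
    by rewrite [u k * t]mulrC mulrCA -[t * u k * _]mulrA.
  by rewrite subr_ge0 le_dpow// lerD2r ler_wpM2r// ler_nat.
move: Kt; set X := t * _; set Y := (\sum_(i < n) _ * u _) => KX Y1 Y2 Y3.
have : u k * K < u k * (1 - p + X) by rewrite ltr_pM2l.
rewrite mulrDr ltNge => /negP; apply.
rewrite [u k * K]mulrC (le_trans _ Y2)// (le_trans _ Y3)//.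
exact: lerD (lexx _) Y1.
Qed.

(** The bound on the truncated integrals is uniform in [N], so monotone convergence removes the
    truncation. The additional 1 accounts for the complement of [U m], where [f <= m] almost
    everywhere. *)
Lemma exp_average_le :
  (\int[mu]_(x in `[c, d]) (expR (f x))%:E <=
   ((C + 1) * (expR m * (d - c)))%:E)%E.
Proof.
pose g (j : nat) x : \bar R := (expR (Num.min (f x) j%:R))%:E.
have mg j : measurable_fun `[c, d] (g j).
  by apply/measurable_EFinP; exact: mw.
have g0 j x : `[c, d]%classic x -> (0 <= g j x)%E by rewrite lee_fin expR_ge0.
have gS x : `[c, d]%classic x -> {homo g^~ x : i j / (i <= j)%N >-> (i <= j)%E}.
  move=> _ i j ij; rewrite lee_fin ler_expR le_min ge_min lexx/=.
  by rewrite ge_min ler_nat ij orbT.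
have gE x : limn (g^~ x) = (expR (f x))%:E.
  apply/cvg_lim => //; apply: cvg_near_cst.
  near=> j; rewrite /g; congr (expR _)%:E; apply/min_idPl.
  by near: j; exact: nbhs_infty_ger.
have -> : (\int[mu]_(x in `[c, d]) (expR (f x))%:E =
    \int[mu]_(x in `[c, d]) (fun x => limn (g^~ x)) x)%E.
  by apply: eq_integral => x _; rewrite gE.
rewrite (monotone_convergence mu (measurable_itv _) mg g0 gS).
apply: lime_le.
  apply: ereal_nondecreasing_is_cvgn => i j ij.
  apply: ge0_le_integral => //; [exact: g0|exact: mg|exact: mg|].
  by move=> x xcd; exact: gS.
apply: nearW => j; rewrite -EFin_Rintegral//; last exact: wi.
rewrite lee_fin (le_trans (total _))// mulrDl mul1r lerD2r.
rewrite (le_trans (W_bound j%:R (lexx m)))//.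
rewrite ler_wpM2l//; first by rewrite ltW// divr_gt0 ?mulr_gt0 ?expR_gt0 ?subr_gt0.
by rewrite mulrC ler_wpM2l// expR_ge0.
Unshelve. all: by end_near. Qed.

End Ratio.
End ExpBound.

(** * Continuity and differentiability of |x|^p *)

Section NormPower.
Context {R : realType}.
Implicit Types (p q x y : R).

Lemma continuous_norm_powR q : 0 < q -> continuous (fun y : R => `|y| `^ q).
Proof.
move=> q0 y; have [->|y0] := eqVneq y 0.
  apply/cvgrPdist_lt => e e0; rewrite normr0 powR0 ?gt_eqF//.
  have d0 : 0 < e `^ q^-1 by rewrite powR_gt0.
  near=> z.
  have zd : `|z| < e `^ q^-1.
    by near: z; exists (e `^ q^-1) => // z /=; rewrite sub0r normrN.
  rewrite sub0r normrN ger0_norm ?powR_ge0//.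
  have -> : e = (e `^ q^-1) `^ q.
    by rewrite -powRrM mulVf ?gt_eqF// powRr1// ltW.
  by rewrite gt0_ltr_powR ?nnegrE ?powR_ge0.
apply: (@continuous_comp _ _ _ (fun y : R => `|y|) (fun a => a `^ q)).
  exact: norm_continuous.
apply: differentiable_continuous; apply/derivable1_diffP.
by apply: derivable_powR; rewrite in_itv/= andbT normr_gt0.
Unshelve. all: by end_near. Qed.

(** Positive and negative parts replace the discontinuous sign, so that the continuity of [dpow] at
    0 becomes visible. *)
Lemma dpow_maxE p y : 1 < p -> dpow p y =
  p * (`|Num.max 0 y| `^ (p - 1) - `|Num.max 0 (- y)| `^ (p - 1)).
Proof.
(* The power of 0 with exponent 0 is 1, so the vanishing part contributes 0 only because the
   exponent is nonzero. *)
move=> p1; have p10 : p - 1 != 0 by lra.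
have : [|| y < 0, 0 < y | y == 0] by case: ltgtP.
rewrite /dpow => /or3P[y0|y0|/eqP->].
- rewrite ltr0_sg// (_ : Num.max 0 y = 0); last by apply/max_idPl; lra.
  rewrite (_ : Num.max 0 (- y) = - y); last by apply/max_idPr; lra.
  by rewrite normrN normr0 powR0// sub0r mulrN1 mulNr mulrN.
- rewrite gtr0_sg// (_ : Num.max 0 y = y); last by apply/max_idPr; lra.
  rewrite (_ : Num.max 0 (- y) = 0); last by apply/max_idPl; lra.
  by rewrite normr0 powR0// subr0 mulr1.
- by rewrite sgr0 oppr0 subrr !mulr0 mul0r.
Qed.

Lemma continuous_dpow p : 1 < p -> continuous (dpow p).
Proof.
move=> p1; have p10 : 0 < p - 1 by lra.
rewrite (_ : dpow p = fun y =>
    p * (`|Num.max 0 y| `^ (p - 1) - `|Num.max 0 (- y)| `^ (p - 1))); last first.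
  by apply/funext => y; exact: dpow_maxE.
move=> y; apply: cvgMr; apply: cvgB.
- apply: (@continuous_comp _ _ _ (fun y => Num.max 0 y) (fun a : R => `|a| `^ (p - 1))).
    by apply: continuous_max => //; exact: cvg_cst.
  exact: continuous_norm_powR.
- apply: (@continuous_comp _ _ _ (fun y => Num.max 0 (- y)) (fun a : R => `|a| `^ (p - 1))).
    apply: continuous_max; first exact: cvg_cst.
    by apply: continuousN.
  exact: continuous_norm_powR.
Qed.

(** The tangent inequalities at [y] and [h + y] squeeze the difference quotient between [dpow p y]
    and [dpow p (h + y)], and [dpow] is continuous. *)
Lemma is_derive_norm_powR p y : 1 < p ->
  is_derive y 1 (fun x : R => `|x| `^ p) (dpow p y).
Proof.
move=> p1.
have H : h^-1 *: (`|h *: 1 + y| `^ p - `|y| `^ p) @[h --> 0^'] --> dpow p y.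
  apply/cvgrPdist_le => e e0.
  have /cvgrPdist_le/(_ e e0) := @continuous_dpow p p1 y.
  move=> [r /= r0 rH]; exists r => //= h /=.
  rewrite sub0r normrN => hr h0.
  have := rH (h + y); rewrite /ball_/= opprD addrCA subrr addr0 normrN => /(_ hr).
  rewrite /GRing.scale/= mulr1 => H1; apply: le_trans H1.
  have := pow_tangent (h + y) y p1; have := pow_tangent y (h + y) p1.
  rewrite addrK (_ : y - (h + y) = - h); last lra.
  move: (`|h + y| `^ p) (`|y| `^ p) (dpow p y) (dpow p (h + y)) => b a u v H1 H2.
  have hn : 0 < `|h| by rewrite normr_gt0.
  rewrite -(ler_pM2l hn) -!normrM mulrBr mulVKf// [h * (u - v)]mulrBr.
  rewrite ler0_norm; last lra.
  rewrite ler0_norm; lra.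
split; last by apply/cvg_lim.
by apply/cvg_ex; exists (dpow p y).
Qed.

End NormPower.

(** * Truncated moments of the exponential law *)

Section GammaIntegral.
Context {R : realType}.
Local Notation mu := (@lebesgue_measure R).
Implicit Types (g : R -> R) (a b p x y S T r : R).

Lemma continuous_integrable g a b : continuous g ->
  mu.-integrable `[a, b] (EFin \o g).
Proof.
move=> cg; apply: continuous_compact_integrable; first exact: segment_compact.
exact: continuous_subspaceT.
Qed.

Lemma is_derive_expRN x : is_derive x 1 (fun t : R => - expR (- t)) (expR (- x)).
Proof.
have H := is_derive1_comp (is_derive_expR (- x)) (is_deriveNid x 1).
have -> : expR (- x) = - (expR (- x) * -1) by rewrite mulrN1 opprK.
exact: is_deriveN.
Qed.

Lemma continuous_expRN : continuous (fun t : R => expR (- t)).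
Proof.
by move=> x; apply: continuous_comp; [exact: continuousN|exact: continuous_expR].
Qed.

Lemma derivable_LRcontinuous g dg a b : (forall x : R, is_derive x 1 g (dg x)) ->
  derivable_oo_LRcontinuous g a b.
Proof.
move=> gd.
have cg x : {for x, continuous g}.
  by apply: differentiable_continuous; apply/derivable1_diffP; case: (gd x).
split; first by move=> x _; case: (gd x).
- exact/cvg_at_right_filter/cg.
- exact/cvg_at_left_filter/cg.
Qed.

Lemma Rintegral_expRN a b : a <= b ->
  \int[mu]_(t in `[a, b]) expR (- t) = expR (- a) - expR (- b).
Proof.
rewrite le_eqVlt => /predU1P[->|ab]; first by rewrite set_itv1 Rintegral_set1 subrr.
have := @continuous_FTC2 R (fun t => expR (- t)) (fun t => - expR (- t)) a b ab.
rewrite /Rintegral => ->//=.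
- by rewrite opprK addrC.
- exact/continuous_subspaceT/continuous_expRN.
- exact: derivable_LRcontinuous is_derive_expRN.
- by move=> x _; rewrite derive1E; have [_ ->] := is_derive_expRN x.
Qed.

(** Up to the truncation at [T], the mean of |X - 1|^p for an exponential X, minus 1, after
    integration by parts. *)
Definition dpow_laplace p T : R :=
  \int[mu]_(x in `[0, T]) (dpow p (x - 1) * expR (- x)).

Lemma continuous_dpow_laplace p : 1 < p ->
  continuous (fun x : R => dpow p (x - 1) * expR (- x)).
Proof.
move=> p1 x; apply: cvgM; last exact: continuous_expRN.
apply: (@continuous_comp _ _ _ (fun x => x - 1) (dpow p)).
  by apply: cvgB; [exact: cvg_id|exact: cvg_cst].
exact: continuous_dpow.
Qed.

Lemma dpow_laplace_step p x y : 1 < p -> 0 <= x -> x <= y ->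
  dpow_laplace p y - dpow_laplace p x <=
  dpow p (y - 1) * (expR (- x) - expR (- y)).
Proof.
move=> p1 x0 xy.
have ig a b := @continuous_integrable _ a b (continuous_dpow_laplace p1).
have ie a b := @continuous_integrable _ a b continuous_expRN.
rewrite /dpow_laplace Rintegral_itvB ?bnd_simp//.
rewrite Rintegral_itv_obnd_cbnd; last first.
  by apply: integrableS (ig x y) => //; exact: subset_itv_oc_cc.
rewrite -Rintegral_expRN// -RintegralZl//.
apply: le_Rintegral => //; first by apply: integrableRZ.
move=> t; rewrite /= in_itv/= => /andP[xt ty].
by rewrite ler_wpM2r ?expR_ge0// le_dpow// lerD2r.
Qed.

(** Integration by parts: the boundary term at 0 is the 1, and the one at [T] is nonpositive and
    dropped. *)
Lemma pow_laplace_le p T : 1 < p -> 0 < T ->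
  \int[mu]_(x in `[0, T]) (`|x - 1| `^ p * expR (- x)) <= 1 + dpow_laplace p T.
Proof.
move=> p1 T0.
have dF x : is_derive x 1 (fun x : R => `|x - 1| `^ p) (dpow p (x - 1)).
  have H : is_derive x 1 (fun x : R => x - 1) 1.
    by apply: is_derive_eq; rewrite subr0.
  have := @is_derive1_comp R (fun y => `|y| `^ p) (fun x => x - 1) x _ _
    (is_derive_norm_powR (x - 1) p1) H.
  by rewrite mulr1.
have cp : continuous (fun x : R => dpow p (x - 1)).
  move=> x; apply: (@continuous_comp _ _ _ (fun x => x - 1) (dpow p)).
    by apply: cvgB; [exact: cvg_id|exact: cvg_cst].
  exact: continuous_dpow.
have := @Rintegration_by_parts R (fun x => `|x - 1| `^ p) (fun t => - expR (- t))
  (fun x => dpow p (x - 1)) (fun t => expR (- t)) 0 T T0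
  (continuous_subspaceT cp) (derivable_LRcontinuous _ _ dF) _
  (continuous_subspaceT continuous_expRN)
  (derivable_LRcontinuous _ _ is_derive_expRN) _.
move=> ->; first last.
- by move=> x _; rewrite derive1E; have [_ ->] := is_derive_expRN x.
- by move=> x _; rewrite derive1E; have [_ ->] := dF x.
rewrite sub0r normrN1 powR1 oppr0 expR0 mul1r opprK.
under eq_Rintegral do rewrite mulrN -mulN1r.
rewrite RintegralZl//; last exact/continuous_integrable/continuous_dpow_laplace.
rewrite mulN1r opprK -/(dpow_laplace p T) lerD2r.
by rewrite gerDr mulrN oppr_le0 mulr_ge0 ?powR_ge0 ?expR_ge0.
Qed.

End GammaIntegral.

(** * Relation of these moments to the Gamma function *)

Section GammaLink.
Context {R : realType}.
Local Notation mu := (@lebesgue_measure R).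
Implicit Types (g : R -> R) (a b p x y S T r t : R).

(** The summand 1 covers [t <= 1]; for larger [t], the power is raised to an integer exponent and
    bounded by a term of the exponential series at [t / 2]. *)
Lemma powR_le_expR p t : 0 <= p -> 0 <= t ->
  t `^ p <= (1 + 2 ^+ (Num.trunc p).+1 * (Num.trunc p).+1`!%:R) * expR (t / 2).
Proof.
move=> p0 t0; set n := Num.trunc p.
have pn : p <= n.+1%:R by rewrite ltW// truncnS_gt.
have e1 : 1 <= expR (t / 2) by rewrite -expR0 ler_expR divr_ge0.
have f0 : 0 < n.+1`!%:R :> R by rewrite ltr0n fact_gt0.
have te : t ^+ n.+1 <= 2 ^+ n.+1 * n.+1`!%:R * expR (t / 2).
  have := @expR_ge1Dxn R (t / 2) n; rewrite divr_ge0// => /(_ isT) H.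
  have {}H : (t / 2) ^+ n.+1 / n.+1`!%:R <= expR (t / 2) by lra.
  have -> : t ^+ n.+1 = 2 ^+ n.+1 * (t / 2) ^+ n.+1.
    by rewrite -exprMn mulrC divfK.
  rewrite -mulrA ler_wpM2l ?exprn_ge0//.
  by rewrite [leRHS]mulrC -ler_pdivrMr.
have c0 : 0 <= 2 ^+ n.+1 * n.+1`!%:R * expR (t / 2).
  by rewrite !mulr_ge0 ?expR_ge0 ?exprn_ge0// ltW.
rewrite mulrDl mul1r; have [t1|t1] := leP t 1.
  rewrite (@le_trans _ _ 1)//; last lra.
  have := @ge0_ler_powR R p p0 t 1; rewrite !nnegrE powR1 ler01 t0.
  by apply.
apply: le_trans (_ : t ^+ n.+1 <= _); last lra.
by rewrite -powR_mulrn// ler_powR// ltW.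
Qed.

Lemma gamma_integrable p : 1 <= p ->
  mu.-integrable `]0, +oo[ (EFin \o (fun t => t `^ (p - 1) * expR (- t))).
Proof.
move=> p1.
pose C : R := 1 + 2 ^+ (Num.trunc (p - 1)).+1 * (Num.trunc (p - 1)).+1`!%:R.
have half0 : 0 < 2^-1 :> R by rewrite invr_gt0.
(* The dominating function is [C * expR (- t / 2)]; the factor 2 cancels the rate in the exponential
   density. *)
have : mu.-integrable `]0, +oo[ (EFin \o (fun t => 2 * C * exponential_pdf 2^-1 t)).
  apply: integrableRZ => //.
  have H := integrable_exponential_pdf half0.
  by apply: integrableS H.
apply: le_integrableR => //.
  apply: measurable_funM.
    by apply: measurable_funTS; exact: measurable_powR.
  apply: measurable_funTS; apply: continuous_measurable_fun.
  exact: continuous_expRN.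
move=> t; rewrite /= in_itv/= andbT => t0.
rewrite ger0_norm ?mulr_ge0 ?powR_ge0 ?expR_ge0//.
rewrite exponential_pdfE; last by rewrite ltW.
have := @powR_le_expR (p - 1) t; rewrite subr_ge0 => /(_ p1 (ltW t0)).
rewrite -/C => H.
apply: (le_trans (ler_wpM2r (expR_ge0 (- t)) H)).
rewrite -[leLHS]mulrA -expRD mulrACA [_ + - t](_ : _ = - 2^-1 * t); last lra.
by rewrite divff// mul1r.
Qed.

Lemma Gamma_ge p S : 1 <= p ->
  \int[mu]_(t in `]0, S]) (t `^ (p - 1) * expR (- t)) <= Gamma p.
Proof.
move=> p1; apply: subset_Rintegral => //; first exact: gamma_integrable.
  by move=> t _; rewrite mulr_ge0 ?powR_ge0 ?expR_ge0.
by move=> t /=; rewrite !in_itv/= andbT => /andP[].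
Qed.

Lemma Gamma_approx p r : 1 <= p -> r < Gamma p -> exists n : nat,
  r < \int[mu]_(t in `]0, n%:R]) (t `^ (p - 1) * expR (- t)).
Proof.
move=> p1 rG; have gi := gamma_integrable p1.
have gin S : mu.-integrable `]0, S] (EFin \o (fun t => t `^ (p - 1) * expR (- t))).
  by apply: integrableS gi => // t /=; rewrite !in_itv/= andbT => /andP[].
pose q (t : R) := t `^ (p - 1) * expR (- t).
pose D (n : nat) : set R := `]0, n%:R]%classic.
have cv : (\int[mu]_(t in D n) (q t)%:E)%E @[n --> \oo]
    --> (\int[mu]_(t in \bigcup_n D n) (q t)%:E)%E.
  apply: ge0_nondecreasing_set_cvg_integral => //.
  - move=> n m nm; apply/subsetPset => t; rewrite /D /= !in_itv/= => /andP[-> tn].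
    by rewrite (le_trans tn)// ler_nat.
  - by move=> n; exact: measurable_itv.
  - by move=> n; apply/measurable_EFinP; exact: integrable_measurableR (gin n%:R).
  - by move=> n t _; rewrite lee_fin mulr_ge0 ?powR_ge0 ?expR_ge0.
have DE : \bigcup_n D n = `]0, +oo[%classic.
  by rewrite itv_bndy_bigcup_BRight; apply: eq_bigcupr => n _; rewrite add0r.
have rG' : (r%:E < \int[mu]_(t in \bigcup_n D n) (q t)%:E)%E.
  by rewrite DE -EFin_Rintegral// lte_fin.
have nb : nbhs (\int[mu]_(t in \bigcup_n D n) (q t)%:E)%E [set x | (r%:E < x)%E].
  by apply: open_nbhs_nbhs; split => //; exact: open_ereal_gt_ereal.
have [n _ /(_ n (leqnn n))] := cv _ nb.
rewrite /= -EFin_Rintegral; [|exact: measurable_itv|exact: gin].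
by rewrite lte_fin => H; exists n.
Qed.

(** The integral is split at 1, where [dpow p (x - 1)] changes sign; the substitutions [x = 1 - t]
    and [x = 1 + t] each bring out the factor [p / expR 1]. *)
Lemma dpow_laplaceE p S : 1 < p -> 0 < S ->
  dpow_laplace p (1 + S) = p / expR 1 *
    (\int[mu]_(t in `]0, S]) (t `^ (p - 1) * expR (- t)) -
     \int[mu]_(t in `[0, 1]) (t `^ (p - 1) * expR t)).
Proof.
move=> p1 S0.
have p10 : p - 1 != 0 by lra.
have cG := continuous_dpow_laplace p1.
have iG a b := @continuous_integrable _ _ a b cG.
pose G x := dpow p (x - 1) * expR (- x).
have dpowp t : 0 <= t -> dpow p t = p * t `^ (p - 1).
  rewrite le_eqVlt => /predU1P[<-|t0].
    by rewrite /dpow sgr0 powR0// !mulr0 mul0r.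
  by rewrite /dpow gtr0_sg// mulr1 gtr0_norm.
have dpown t : 0 <= t -> dpow p (- t) = - (p * t `^ (p - 1)).
  by move=> t0; rewrite -dpowp// /dpow sgrN normrN mulrN mulNr.
have iq (e : R -> R) a b : continuous e -> 0 <= a ->
    mu.-integrable `[a, b] (EFin \o (fun t => t `^ (p - 1) * e t)).
  move=> ce a0.
  have : mu.-integrable `[a, b] (EFin \o (fun t => `|t| `^ (p - 1) * e t)).
    apply: continuous_integrable => t; apply: cvgM; last exact: ce.
    by apply: continuous_norm_powR; lra.
  apply: eq_integrable => // t; rewrite inE /= in_itv/= => /andP[at_ _].
  by rewrite ger0_norm// (le_trans a0).
have eD x y : expR (x + y) = expR x * expR y := expRD x y.
have -> : dpow_laplace p (1 + S) =
    \int[mu]_(x in `[0, 1]) G x + \int[mu]_(x in `[1, 1 + S]) G x.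
  rewrite -(@Rintegral_itv_obnd_cbnd _ 1); last first.
    by apply: integrableS (iG 1 (1 + S)) => //; exact: subset_itv_oc_cc.
  rewrite -(@Rintegral_itvB _ G (BLeft 0) (BRight (1 + S)) 1); last 3 first.
  - exact: iG.
  - by rewrite bnd_simp.
  - by rewrite bnd_simp lerDl ltW.
  by rewrite [RHS]addrC subrK.
have -> : \int[mu]_(x in `[0, 1]) G x = - (p / expR 1) *
    \int[mu]_(t in `[0, 1]) (t `^ (p - 1) * expR t).
  have r01 : 0 <= (1 : R) <= 1 by rewrite ler01 lexx.
  rewrite (Rintegration_by_substitution_onem r01 (continuous_subspaceT cG)).
  rewrite /onem subrr -RintegralZl//.
    apply: eq_Rintegral => t; rewrite inE /= in_itv/= => /andP[t0 t1].
    rewrite /G (_ : 1 - t - 1 = - t); last lra.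
    rewrite dpown// opprB eD expRN; lra.
  by apply: iq => //; exact: continuous_expR.
have -> : \int[mu]_(x in `[1, 1 + S]) G x = p / expR 1 *
    \int[mu]_(t in `]0, S]) (t `^ (p - 1) * expR (- t)).
  have D1 : derive1 (fun x : R => x + 1) = cst 1.
    apply/funext => x; rewrite derive1E.
    have H : is_derive x 1 (fun x : R => x + 1) 1.
      by apply: is_derive_eq; rewrite addr0.
    by have [_ ->] := H.
  have dF x : is_derive x 1 (fun x : R => x + 1) (cst 1 x).
    by apply: is_derive_eq; rewrite addr0.
  have := @integration_by_substitution_increasing R (fun x => x + 1) G 0 S (ltW S0).
  rewrite add0r D1 [S + 1]addrC => H.
  rewrite /Rintegral H; first last.
  - exact: continuous_subspaceT.
  - exact: (derivable_LRcontinuous _ _ dF).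
  - exact: is_cvg_cst.
  - exact: is_cvg_cst.
  - by move=> x _; exact: cvg_cst.
  - by move=> x y _ _; rewrite ltrD2r.
  rewrite -/(Rintegral _ _ _) Rintegral_itv_obnd_cbnd; last first.
    by apply: integrableS (iq _ 0 S continuous_expRN (lexx _)) => //;
      exact: subset_itv_oc_cc.
  rewrite -RintegralZl//; last by apply: iq => //; exact: continuous_expRN.
  apply: eq_Rintegral => t; rewrite inE /= in_itv/= => /andP[t0 _].
  rewrite !fctE mulr1 /G addrK dpowp// opprD eD (expRN 1); lra.
lra.
Qed.

End GammaLink.

(** * The John-Nirenberg inequality below the claimed constant *)

Section LowerBound.
Context {R : realType}.
Local Notation mu := (@lebesgue_measure R).
Implicit Types (a b c d p e K h t : R).

Definition jn_constant p : R := p / expR 1 *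
  (Gamma p - \int[mu]_(t in `[0, 1]) (t `^ (p - 1) * expR t)) + 1.

(* Abel summation, followed by a comparison with the integral that is shifted
   by one step of the grid. *)
Lemma slope_sum_ge p h n : 1 < p -> 0 <= h ->
  expR (- h) * (p + dpow_laplace p (n%:R * h)) +
    dpow p (n.+1%:R * h - 1) * expR (- (n.+1%:R * h)) <=
  \sum_(i < n.+1) (dpow p (i.+1%:R * h - 1) - dpow p (i%:R * h - 1)) *
    expR (- (i.+1%:R * h)).
Proof.
move=> p1 h0; elim: n => [|n IH].
  rewrite big_ord_recr big_ord0/= add0r mul1r !mul0r sub0r dpowN1.
  rewrite /dpow_laplace set_itv1 Rintegral_set1; lra.
rewrite big_ord_recr/=; apply: le_trans (lerD IH (lexx _)).
have nh0 : 0 <= n%:R * h by rewrite mulr_ge0.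
have nS : n%:R * h <= n.+1%:R * h by rewrite ler_wpM2r// ler_nat.
have := ler_wpM2l (expR_ge0 (- h)) (dpow_laplace_step p1 nh0 nS).
have eS (i : nat) : expR (- (i.+1%:R * h)) = expR (- h) * expR (- (i%:R * h)).
  by rewrite -expRD -natr1; congr expR; lra.
rewrite (eS n.+1) (eS n).
move: (dpow p _) (dpow p _) (dpow_laplace _ _) (dpow_laplace _ _) (expR _) (expR _).
move=> u v x y E F; lra.
Qed.

Lemma dpow_laplace_le p T : 1 < p -> 1 < T -> 1 + dpow_laplace p T <= jn_constant p.
Proof.
move=> p1 T1; rewrite /jn_constant addrC lerD2r.
have -> : T = 1 + (T - 1) by lra.
rewrite dpow_laplaceE ?subr_gt0// ler_wpM2l//.
  by rewrite divr_ge0 ?expR_ge0// ltW// (lt_trans ltr01).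
by rewrite lerD2r Gamma_ge// ltW.
Qed.

Lemma jn_constant_ge0 p : 1 < p -> 0 <= jn_constant p.
Proof.
move=> p1; apply: le_trans (dpow_laplace_le p1 (_ : 1 < 2)); last lra.
apply: le_trans (pow_laplace_le p1 (_ : 0 < 2)); last lra.
by apply: Rintegral_ge0 => x _; rewrite mulr_ge0 ?powR_ge0 ?expR_ge0.
Qed.

(** The cut-off [L] is fixed first, so that [K - 1 < dpow_laplace p L%:R]. The mesh [h = 1 / M] then
    makes [L * M] steps end exactly at [L]. Two factors [expR (- h)] are lost, one in [slope_sum_ge]
    and one as [t]; together they are at least [1 - 2 * h]. *)
Lemma exists_grid p K : 1 < p -> 0 <= K -> K < jn_constant p ->
  exists h t (n : nat), [/\ 0 <= h, 0 < t, t < 1 &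
    K < 1 - p + t * \sum_(i < n)
      (dpow p (i.+1%:R * h - 1) - dpow p (i%:R * h - 1)) * expR (- (i.+1%:R * h))].
Proof.
move=> p1 K0 KJ; have p0 : 0 < p by lra.
have pe0 : 0 < p / expR 1 by rewrite divr_gt0 ?expR_gt0.
set I := \int[mu]_(t in `[0, 1]) (t `^ (p - 1) * expR t).
pose r := (K - 1) / (p / expR 1) + I.
have rG : r < Gamma p.
  by rewrite /r -ltrBrDr ltr_pdivrMr// ltrBlDr mulrC.
have [n0 rn0] := Gamma_approx (ltW p1) rG.
(* One unit is the shift in [dpow_laplaceE]; the other keeps its parameter [S = n0 + 1] positive. *)
pose L : nat := n0.+2.
have AL : K - 1 < dpow_laplace p L%:R.
  have -> : L%:R = 1 + n0.+1%:R :> R by rewrite /L -natr1 addrC.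
  rewrite dpow_laplaceE// mulrC -ltr_pdivrMr// -/I ltrBrDr.
  apply: lt_le_trans rn0 _.
  apply: subset_Rintegral => //.
  - apply: integrableS (gamma_integrable (ltW p1)) => // x /=.
    by rewrite !in_itv/= andbT => /andP[].
  - by move=> x _; rewrite mulr_ge0 ?powR_ge0 ?expR_ge0.
  - move=> x; rewrite /= !in_itv/= => /andP[-> xn].
    by rewrite (le_trans xn)// ler_nat.
pose a := p + dpow_laplace p L%:R; pose b := p - 1 + K.
have b0 : 0 < b by rewrite /b; lra.
have ba : b < a by rewrite /a /b; lra.
pose M := (Num.trunc (2 * a / (a - b))).+1.
have M0 : 0 < M%:R :> R by rewrite ltr0n.
have aM : 2 * a / (a - b) < M%:R by rewrite truncnS_gt.
pose h := M%:R^-1 : R.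
have h0 : 0 < h by rewrite invr_gt0.
have hM : h * M%:R = 1 by rewrite /h mulVf// gt_eqF.
have hab : b < (1 - 2 * h) * a.
  have : 2 * a < M%:R * (a - b) by rewrite -ltr_pdivrMr// subr_gt0.
  rewrite -(ltr_pM2l h0) [h * (M%:R * _)]mulrA hM mul1r; lra.
exists h, (expR (- h)), (L * M).+1; split; [exact: ltW|exact: expR_gt0| |].
  by rewrite expR_lt1 oppr_lt0.
have := slope_sum_ge (L * M) p1 (ltW h0).
rewrite {1}natrM -mulrA mulfV ?gt_eqF// mulr1 -/a.
have : 0 <= dpow p ((L * M).+1%:R * h - 1) * expR (- ((L * M).+1%:R * h)).
  rewrite mulr_ge0 ?expR_ge0//.
  have -> : 0 = dpow p 0 by rewrite /dpow sgr0 mulr0 mul0r.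
  rewrite le_dpow// subr_ge0 /h -(@ler_pM2r _ M%:R)// mul1r divfK ?gt_eqF//.
  by rewrite ler_nat ltnW// ltnS leq_pmull.
set S := \sum_(i < _) _; set X := _ * expR (- (_ * h)) => X0 XS.
have e0 := expR_gt0 (- h).
have : expR (- h) * (expR (- h) * a) <= expR (- h) * S.
  by rewrite ler_pM2l//; lra.
have : (1 - 2 * h) * a <= expR (- h) * (expR (- h) * a).
  rewrite mulrA ler_wpM2r//; first by lra.
  rewrite -expRD; apply: le_trans (expR_ge1Dx _); lra.
rewrite /b in hab; lra.
Qed.

Lemma bmo_norm_osc p e a b phi : 0 < p -> 0 <= e ->
  (bmo_norm p a b phi <= e%:E)%E -> forall c d, a <= c -> c < d -> d <= b ->
  (\int[mu]_(x in `[c, d]) (`|phi x - average c d phi| `^ p)%:E <=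
   (e `^ p * (d - c))%:E)%E.
Proof.
move=> p0 e0 phie c d ac cd db.
have := le_trans (ereal_sup_ubound _) phie.
move=> /(_ (poweR (eaverage c d (fun x => `|phi x - average c d phi| `^ p)) p^-1)).
move=> /(_ (ex_intro _ c (ex_intro _ d (And4 ac cd db erefl)))).
rewrite /eaverage; set I := (\int[mu]_(x in _) _)%E => Ie.
have I0 : (0 <= I)%E by apply: integral_ge0 => x _; rewrite lee_fin powR_ge0.
have dc0 : 0 < d - c by rewrite subr_gt0.
have J0 : (0 <= (d - c)^-1%:E * I)%E.
  by rewrite mule_ge0// lee_fin invr_ge0 ltW.
have : ((d - c)^-1%:E * I <= (e `^ p)%:E)%E.
  (* An infinite average is excluded, as its root would be infinite too. *)
  move: Ie J0; case: (_ * I)%E => [s| |]; last by []; last first.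
    by rewrite poweRyr ?invr_eq0 ?gt_eqF.
  rewrite poweR_EFin !lee_fin => se s0.
  have -> : s = (s `^ p^-1) `^ p by rewrite -powRrM mulVf ?gt_eqF// powRr1.
  by rewrite ge0_ler_powR ?nnegrE ?powR_ge0// ltW.
by rewrite lee_pdivrMl// -EFinM mulrC.
Qed.

Lemma john_nirenberg_lower p e : 1 < p -> 0 <= e -> e `^ p < jn_constant p ->
  john_nirenberg_at p e.
Proof.
move=> p1 e0 eJ; have p0 : 0 < p by lra.
have [h [t [n [h0 t0 t1 Kt]]]] := exists_grid p1 (powR_ge0 e p) eJ.
(* The grid comes from [p] and [e] alone, before the interval and [phi] are introduced, so the
   constant is uniform. *)
exists (2 * expR (n%:R * h) / (1 - t) + 1).
  by rewrite ltr_wpDr// divr_gt0 ?mulr_gt0 ?expR_gt0 ?subr_gt0.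
move=> a b phi ab [phii _] phie c d ac cd db.
have cdab : `[c, d] `<=` `[a, b] by move=> x /=; rewrite !in_itv/=; lra.
have fi : mu.-integrable `[c, d] (EFin \o phi) by apply: integrableS phii.
have oscE := bmo_norm_osc p0 e0 phie.
have fpi x y : c <= x -> x < y -> y <= d ->
    mu.-integrable `[x, y] (EFin \o (fun z => `|phi z - average x y phi| `^ p)).
  move=> cx xy yd; have xyd : `[x, y] `<=` `[c, d].
    by move=> z /=; rewrite !in_itv/=; lra.
  apply/integrableP; split.
    apply/measurable_EFinP; apply: measurable_pow_norm.
    by apply: measurable_funS (integrable_measurableR fi).
  under eq_integral do rewrite /= ger0_norm ?powR_ge0//.
  by rewrite (le_lt_trans (oscE x y _ _ _)) ?ltry//; lra.
have osc x y : c <= x -> x < y -> y <= d ->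
    \int[mu]_(z in `[x, y]) (`|phi z - average x y phi| `^ p) <= e `^ p * (y - x).
  move=> cx xy yd; rewrite -lee_fin EFin_Rintegral//; last exact: fpi.
  by apply: oscE => //; lra.
have := exp_average_le p1 cd fi (fpi _ _ (lexx c) cd (lexx d)) osc h0 t0 t1 Kt.
rewrite /eaverage => H.
rewrite lee_pdivrMl ?subr_gt0// (le_trans H)// -EFinM lee_fin.
by rewrite le_eqVlt; apply/orP; left; apply/eqP; lra.
Qed.

End LowerBound.

(** * Integrals of the logarithm and limits of cut-off integrals *)

Section Logarithm.
Context {R : realType}.
Local Notation mu := (@lebesgue_measure R).
Implicit Types (f g : R -> R) (a b c d p s t x T : R).

(** An antiderivative of [- ln x] for [x > 0], with value 0 at 0. *)
Definition xlogx x : R := x - x * ln x.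

Lemma is_derive_xlogx c t : c < t ->
  is_derive t 1 (fun t => xlogx (t - c)) (- ln (t - c)).
Proof.
move=> ct; have tc0 : 0 < t - c by rewrite subr_gt0.
have H : is_derive t 1 (fun x : R => x - c) 1.
  by apply: is_derive_eq; rewrite subr0.
have L := is_derive1_ln tc0.
have Lc : is_derive t 1 (fun x => ln (x - c)) (t - c)^-1.
  have := @is_derive1_comp R (@ln R) (fun x => x - c) t _ _ L H.
  by rewrite mulr1.
rewrite /xlogx; apply: is_derive_eq.
rewrite /GRing.scale/= mulr1 mulfV ?gt_eqF//; lra.
Qed.

Lemma continuous_lnB c t : c < t -> {for t, continuous (fun t : R => ln (t - c))}.
Proof.
move=> ct; apply: continuous_comp.
  by apply: cvgB; [exact: cvg_id|exact: cvg_cst].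
by apply: continuous_ln; rewrite subr_gt0.
Qed.

Lemma within_continuous_gt f c a b : c < a ->
  (forall t, c < t -> {for t, continuous f}) -> {within `[a, b], continuous f}.
Proof.
move=> ca cf; apply: continuous_in_subspaceT => t.
rewrite inE /= in_itv/= => /andP[at_ _]; apply: cf.
exact: lt_le_trans at_.
Qed.

Lemma gt_derivable_LRcontinuous f df c a b : c < a -> a < b ->
  (forall t, c < t -> is_derive t 1 f (df t)) -> derivable_oo_LRcontinuous f a b.
Proof.
move=> ca ab fd.
have cf t : c < t -> {for t, continuous f}.
  by move=> /fd[dft _]; apply: differentiable_continuous; apply/derivable1_diffP.
split.
- by move=> t; rewrite in_itv/= => /andP[at_ _]; case: (fd t (lt_trans ca at_)).
- exact/cvg_at_right_filter/cf.
- by apply/cvg_at_left_filter/cf; exact: lt_trans ab.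
Qed.

Lemma Rintegral_lnB c a b : c < a -> a <= b ->
  \int[mu]_(t in `[a, b]) (- ln (t - c)) = xlogx (b - c) - xlogx (a - c).
Proof.
move=> ca; rewrite le_eqVlt => /predU1P[->|ab].
  by rewrite set_itv1 Rintegral_set1 subrr.
have := @continuous_FTC2 R (fun t => - ln (t - c)) (fun t => xlogx (t - c)) a b ab.
rewrite /Rintegral => ->//=.
- by apply: (within_continuous_gt ca) => t ct; apply/continuousN/continuous_lnB.
- exact: gt_derivable_LRcontinuous ca ab (@is_derive_xlogx c).
- move=> t; rewrite in_itv/= => /andP[at_ _]; rewrite derive1E.
  by have [_ ->] := is_derive_xlogx (lt_trans ca at_).
Qed.

Lemma Rintegral_invr a b : 0 < a -> a < b ->
  (\int[mu]_(t in `[a, b]) (t^-1)%:E = (ln b - ln a)%:E)%E.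
Proof.
move=> a0 ab; rewrite EFinB; apply: continuous_FTC2 => //.
- by apply: (within_continuous_gt a0) => t t0; apply: inv_continuous; rewrite gt_eqF.
- exact: gt_derivable_LRcontinuous a0 ab (@is_derive1_ln R).
- move=> t; rewrite in_itv/= => /andP[at_ _]; rewrite derive1E.
  by have [_ ->] := is_derive1_ln (lt_trans a0 at_).
Qed.

(** As a function of [T], the map that carries the exponential law to the uniform law on [[c, d]];
    as a point, a cut-off that avoids the singularity at [c]. *)
Definition exp_approach c d T : R := c + (d - c) * expR (- T).

(** The intervals starting at the cut-offs increase to []c, d]], so the integrals over them converge
    to the full one, while the error [r] disappears. *)
Lemma ge0_integral_le_lim c d f (B : R) (r : nat -> R) : c < d ->
  measurable_fun `]c, d] f -> (forall t, 0 <= f t) -> r n @[n --> \oo] --> 0 ->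
  (\forall n \near \oo, (\int[mu]_(t in `[exp_approach c d n%:R, d]) (f t)%:E
     <= (B + r n)%:E)%E) ->
  (\int[mu]_(t in `[c, d]) (f t)%:E <= B%:E)%E.
Proof.
move=> cd mf f0 r0 fB.
have dc0 : 0 < d - c by rewrite subr_gt0.
pose D (n : nat) : set R := `[exp_approach c d n%:R, d]%classic.
have Dcd n : D n `<=` `]c, d].
  move=> t; rewrite /D /exp_approach /= !in_itv/= => /andP[ct ->]; rewrite andbT.
  by rewrite (lt_le_trans _ ct)// ltrDl mulr_gt0// expR_gt0.
have DE : \bigcup_n D n = `]c, d]%classic.
  apply/seteqP; split => [t [n _ /Dcd]//|t]; rewrite /= in_itv/= => /andP[ct td].
  have tc0 : 0 < (t - c) / (d - c) by rewrite divr_gt0// subr_gt0.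
  pose n := (Num.trunc (- ln ((t - c) / (d - c)))).+1.
  exists n => //; rewrite /D /= in_itv/= td andbT /exp_approach.
  rewrite addrC -lerBrDr mulrC -ler_pdivlMr//.
  rewrite -[leRHS]lnK ?posrE// ler_expR lerNl ltW//.
  by rewrite /n truncnS_gt.
have cv : (\int[mu]_(t in D n) (f t)%:E)%E @[n --> \oo]
    --> (\int[mu]_(t in \bigcup_n D n) (f t)%:E)%E.
  apply: ge0_nondecreasing_set_cvg_integral => //.
  - move=> n m nm; apply/subsetPset => t; rewrite /D /= !in_itv/= => /andP[tn ->].
    rewrite andbT (le_trans _ tn)// /exp_approach lerD2l ler_wpM2l ?(ltW dc0)//.
    by rewrite ler_expR lerN2 ler_nat.
  - by move=> n; exact: measurable_itv.
  - by move=> n; apply/measurable_EFinP; apply: measurable_funS mf => //; exact: Dcd.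
  - by move=> n t _; rewrite lee_fin.
rewrite -integral_itv_obnd_cbnd; last exact/measurable_EFinP.
rewrite -DE -(cvg_lim _ cv)//.
have cB : (B + r n)%:E @[n --> \oo] --> B%:E.
  apply: cvg_EFin; first exact: nearW.
  by rewrite -[X in _ --> X]addr0; apply: cvgD => //; exact: cvg_cst.
rewrite -(cvg_lim _ cB)//.
apply: lee_lim => //.
- by apply/cvg_ex; eexists; exact: cv.
- by apply/cvg_ex; eexists; exact: cB.
Qed.

End Logarithm.

(** * The p-th moment of the logarithm by exponential substitution *)

Section LogOscillation.
Context {R : realType}.
Local Notation mu := (@lebesgue_measure R).
Implicit Types (f g : R -> R) (a b c d p s t x T : R).

Lemma exp_approach_gt c d T : c < d -> c < exp_approach c d T.
Proof. by move=> cd; rewrite ltrDl mulr_gt0 ?expR_gt0 ?subr_gt0. Qed.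

Lemma exp_approach_lt c d T : c < d -> 0 < T -> exp_approach c d T < d.
Proof.
move=> cd T0; rewrite /exp_approach addrC -ltrBrDr.
by rewrite gtr_pMr ?subr_gt0// expR_lt1 oppr_lt0.
Qed.

Lemma cvg_expRNn : expR (- n%:R) @[n --> \oo] --> (0 : R).
Proof.
rewrite (_ : (fun n : nat => _) = fun n => expR (-1) ^+ n); last first.
  by apply/funext => n; rewrite -expRM_natl mulrN1.
by apply: cvg_expr; rewrite ger0_norm ?expR_ge0// expR_lt1 oppr_lt0.
Qed.

(** Half of the exponential absorbs the factor [n], at the price of a constant 2; the other half
    tends to 0. *)
Lemma cvg_nexpRNn : n%:R * expR (- n%:R) @[n --> \oo] --> (0 : R).
Proof.
have e1 : expR (- 2^-1) ^+ n @[n --> \oo] --> (0 : R).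
  by apply: cvg_expr; rewrite ger0_norm ?expR_ge0// expR_lt1 oppr_lt0 invr_gt0.
apply: (@squeeze_cvgr _ _ _ _ (fun=> 0) (fun n => 2 * expR (- 2^-1) ^+ n)).
- apply: nearW => n; rewrite mulr_ge0 ?expR_ge0//=.
  have H : n%:R <= 2 * expR (n%:R * 2^-1) :> R.
    by have := expR_ge1Dx (n%:R * 2^-1 : R); lra.
  have -> : expR (- n%:R) = expR (- (n%:R * 2^-1)) * expR (- 2^-1) ^+ n :> R.
    by rewrite -expRM_natl -expRD; congr expR; lra.
  rewrite mulrA ler_wpM2r ?exprn_ge0 ?expR_ge0//.
  by rewrite expRN ler_pdivrMr ?expR_gt0.
- exact: cvg_cst.
- by rewrite -[X in _ --> X](mulr0 2); apply: cvgMr.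
Qed.

(** The substitution [t = exp_approach c d x] turns the integrand into |x - 1|^p with weight
    [(d - c) * expR (- x)] on [[0, T]]. *)
Lemma log_pow_le p c d T : 1 < p -> c < d -> 1 < T ->
  \int[mu]_(t in `[exp_approach c d T, d])
    (`|- ln ((t - c) / (d - c)) - 1| `^ p) <= jn_constant p * (d - c).
Proof.
move=> p1 cd T1; have dc0 : 0 < d - c by rewrite subr_gt0.
pose F x := exp_approach c d x.
pose G t := `|- ln ((t - c) / (d - c)) - 1| `^ p.
have dF x : is_derive x 1 F (- ((d - c) * expR (- x))).
  rewrite /F /exp_approach.
  have := @is_derive_expRN R x => H.
  have -> : (fun x => c + (d - c) * expR (- x)) =
      (fun x => c - (d - c) * (- expR (- x))).
    by apply/funext => y; lra.
  by apply: is_derive_eq; rewrite /GRing.scale/=; lra.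
have D1 : derive1 F = fun x => - ((d - c) * expR (- x)).
  by apply/funext => x; rewrite derive1E; have [_ ->] := dF x.
have cD1 : continuous (derive1 F).
  rewrite D1 => x; apply: cvgN; apply: cvgMr; exact: continuous_expRN.
have FT : c < F T by exact: exp_approach_gt.
have F0 : F 0 = d by rewrite /F /exp_approach oppr0 expR0; lra.
have cG t : c < t -> {for t, continuous G}.
  move=> ct.
  apply: (@continuous_comp _ _ _ (fun t => - ln ((t - c) / (d - c)) - 1)
    (fun y : R => `|y| `^ p)); last by apply: continuous_norm_powR; lra.
  apply: cvgB; last exact: cvg_cst.
  apply: cvgN; apply: continuous_comp.
    by apply: cvgMl; apply: cvgB; [exact: cvg_id|exact: cvg_cst].
  by apply: continuous_ln; rewrite divr_gt0// subr_gt0.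
have := @integration_by_substitution_decreasing R F G 0 T (ltW (lt_trans ltr01 T1)).
rewrite F0 => H; rewrite -/(F T) /Rintegral H; first last.
- exact: within_continuous_gt cG.
- exact: (derivable_LRcontinuous _ _ dF).
- by apply/cvg_ex; eexists; exact/cvg_at_left_filter/cD1.
- by apply/cvg_ex; eexists; exact/cvg_at_right_filter/cD1.
- by move=> x _; exact: cD1.
- move=> x y _ _ yx; rewrite /F /exp_approach ltrD2l ltr_pM2l// ltr_expR ltrN2//.
rewrite -/(Rintegral _ _ _).
rewrite (_ : Rintegral _ _ _ =
    (d - c) * \int[mu]_(x in `[0, T]) (`|x - 1| `^ p * expR (- x))).
  rewrite mulrC ler_pM2r//.
  apply: le_trans (dpow_laplace_le p1 T1).
  by apply: pow_laplace_le => //; lra.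
rewrite -RintegralZl//; last first.
  apply: continuous_integrable => x; apply: cvgM; last exact: continuous_expRN.
  apply: (@continuous_comp _ _ _ (fun x => x - 1) (fun y : R => `|y| `^ p)).
    by apply: cvgB; [exact: cvg_id|exact: cvg_cst].
  by apply: continuous_norm_powR; lra.
apply: eq_Rintegral => x _; rewrite !fctE D1 opprK.
rewrite /G /F /exp_approach [c + _ - c]addrAC subrr add0r.
rewrite mulrAC divff ?gt_eqF// mul1r expRK opprK; lra.
Qed.

End LogOscillation.

(** * Integrability and averages of [- ln] *)

Section LogNorm.
Context {R : realType}.
Local Notation mu := (@lebesgue_measure R).
Implicit Types (f g : R -> R) (a b c d p s t x T : R).
Local Notation logV := (fun t : R => - ln t).

Lemma gt_continuous_integrable f c a b : c < a ->
  (forall t, c < t -> {for t, continuous f}) -> mu.-integrable `[a, b] (EFin \o f).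
Proof.
move=> ca cf; apply: continuous_compact_integrable; first exact: segment_compact.
exact: within_continuous_gt cf.
Qed.

Lemma continuous_logV t : 0 < t -> {for t, continuous logV}.
Proof. by move=> t0; apply: cvgN; exact: continuous_ln. Qed.

Lemma measurable_logV (A : set R) : measurable_fun A logV.
Proof.
apply: measurable_funTS; apply: measurableT_comp => //; exact: measurable_ln.
Qed.

Lemma Rintegral_logV a b : 0 < a -> a <= b ->
  \int[mu]_(t in `[a, b]) (- ln t) = xlogx b - xlogx a.
Proof.
move=> a0 ab; have := Rintegral_lnB a0 ab; rewrite !subr0 => <-.
by apply: eq_Rintegral => t _; rewrite subr0.
Qed.

Lemma integrable_norm_logV a b : 0 < a ->
  mu.-integrable `[a, b] (EFin \o (fun t => `|- ln t|)).
Proof.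
move=> a0.
have cf t : 0 < t -> {for t, continuous (fun t : R => `|- ln t|)}.
  by move=> t0; apply: cvg_norm; exact: continuous_logV.
exact: gt_continuous_integrable a0 cf.
Qed.

Lemma integrable_logV : mu.-integrable `[0, 1] (EFin \o logV).
Proof.
apply/integrableP; split; first by apply/measurable_EFinP; exact: measurable_logV.
have H : (\int[mu]_(t in `[0%R, 1%R]) (`|- ln t|%R)%:E <= 1%:E)%E.
  apply: (@ge0_integral_le_lim R 0 1 (fun t => `|- ln t|) 1 (fun=> 0)) => //.
  - by apply: (measurableT_comp (@normr_measurable R setT)); exact: measurable_logV.
  - exact: cvg_cst.
  - apply: nearW => n; rewrite addr0.
    set a := exp_approach _ _ _.
    have a0 : 0 < a by apply: exp_approach_gt.
    have a1 : a <= 1.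
      by rewrite /a /exp_approach add0r subr0 mul1r -expR0 ler_expR oppr_le0.
    rewrite -EFin_Rintegral//; last exact: integrable_norm_logV.
    have -> : \int[mu]_(t in `[a, 1]) `|- ln t| = \int[mu]_(t in `[a, 1]) (- ln t).
      apply: eq_Rintegral => t; rewrite inE /= in_itv/= => /andP[_ t1].
      by rewrite ger0_norm// oppr_ge0 ln_le0.
    rewrite lee_fin.
    rewrite Rintegral_logV// /xlogx ln1 mulr0 subr0.
    have : a * ln a <= 0 by rewrite mulr_ge0_le0 ?ln_le0// ltW.
    lra.
by apply: le_lt_trans (ltry 1).
Qed.

Lemma integrable_logV_sub c d : 0 <= c -> d <= 1 ->
  mu.-integrable `[c, d] (EFin \o logV).
Proof.
move=> c0 d1; apply: integrableS integrable_logV => //.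
by move=> t; rewrite /= !in_itv/=; lra.
Qed.

Lemma average_logV c d : 0 <= c -> c < d -> d <= 1 ->
  average c d logV = (d - c)^-1 * (xlogx d - xlogx c).
Proof.
move=> c0 cd d1; rewrite (averageE (integrable_logV_sub c0 d1))//.
congr (_ * _); move: c0; rewrite le_eqVlt => /predU1P[c0|c0]; last first.
  by rewrite Rintegral_logV// ltW.
(* For [c = 0] the integrand is singular at the endpoint: both inequalities are obtained from
   cut-offs [a n], where [xlogx (a n)] is nonnegative and tends to 0. *)
rewrite -c0 in cd *; rewrite {2}/xlogx mul0r subr0 subr0.
have ge0 t : 0 <= t -> t <= 1 -> 0 <= - ln t by move=> *; rewrite oppr_ge0 ln_le0.
pose a n := exp_approach 0 d n%:R.
have a0 n : 0 < a n by exact: exp_approach_gt.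
have ad n : a n <= d.
  by rewrite /a /exp_approach add0r subr0 ger_pMr// -expR0 ler_expR oppr_le0.
have aE n : xlogx (a n) = d * (1 - ln d) * expR (- n%:R) + d * (n%:R * expR (- n%:R)).
  rewrite /xlogx /a /exp_approach add0r subr0 lnM ?posrE ?expR_gt0// expRK; lra.
have xa : xlogx (a n) @[n --> \oo] --> (0 : R).
  rewrite (_ : (fun n => _) = fun n =>
      d * (1 - ln d) * expR (- n%:R) + d * (n%:R * expR (- n%:R))).
    have -> : 0 = d * (1 - ln d) * 0 + d * 0 :> R by rewrite !mulr0 addr0.
    by apply: cvgD; apply: cvgMr; [exact: cvg_expRNn|exact: cvg_nexpRNn].
  by apply/funext => n; exact: aE.
apply/eqP; rewrite eq_le; apply/andP; split.
  rewrite -lee_fin EFin_Rintegral//; last exact: integrable_logV_sub.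
  have -> : (\int[mu]_(t in `[0%R, d]) (- ln t)%:E =
      \int[mu]_(t in `[0%R, d]) (`|- ln t|)%:E)%E.
    apply: eq_integral => t; rewrite inE /= in_itv/= => /andP[t0 td].
    by rewrite ger0_norm// ge0// (le_trans td).
  apply: (@ge0_integral_le_lim R 0 d (fun t => `|- ln t|) _ (fun=> 0)) => //.
  - by apply: (measurableT_comp (@normr_measurable R setT)); exact: measurable_logV.
  - exact: cvg_cst.
  - apply: nearW => n; rewrite addr0 -/(a n).
    rewrite -EFin_Rintegral//; last exact: integrable_norm_logV.
    have -> : \int[mu]_(t in `[a n, d]) `|- ln t| = \int[mu]_(t in `[a n, d]) (- ln t).
      apply: eq_Rintegral => t; rewrite inE /= in_itv/= => /andP[ta td].
      rewrite ger0_norm// ge0//; last exact: le_trans d1.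
      by rewrite ltW// (lt_le_trans (a0 n)).
    rewrite lee_fin.
    rewrite Rintegral_logV// gerBl /xlogx subr_ge0.
    have : a n * ln (a n) <= 0.
      by rewrite mulr_ge0_le0 ?ln_le0 ?(le_trans (ad n))// ltW.
    by have := a0 n; lra.
have cv : xlogx d - xlogx (a n) @[n --> \oo] --> xlogx d.
  by rewrite -[X in _ --> X]subr0; apply: cvgB => //; exact: cvg_cst.
rewrite -(cvg_lim _ cv)//; apply: limr_le; first by apply/cvg_ex; eexists; exact: cv.
apply: nearW => n; rewrite -Rintegral_logV//.
apply: subset_Rintegral => //; first exact: integrable_logV_sub.
  move=> t; rewrite /= in_itv/= => /andP[t0 td].
  by rewrite ge0// (le_trans td).
by move=> t; rewrite /= !in_itv/= => /andP[ta ->]; rewrite andbT ltW// (lt_le_trans (a0 n)).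
Qed.

End LogNorm.

(** * Oscillation of [- ln] and sharpness of the constant *)

Section LogOsc.
Context {R : realType}.
Local Notation mu := (@lebesgue_measure R).
Implicit Types (f g : R -> R) (a b c d p s t x T : R).
Local Notation logV := (fun t : R => - ln t).

Let cont_pow p f t : 1 < p -> {for t, continuous f} ->
  {for t, continuous (fun t => `|f t| `^ p)}.
Proof.
move=> p1 cf; apply: (@continuous_comp _ _ _ f (fun y : R => `|y| `^ p)) => //.
by apply: continuous_norm_powR; lra.
Qed.

Let integrable_pow_logV p a b l : 1 < p -> 0 < a ->
  mu.-integrable `[a, b] (EFin \o (fun t => `|- ln t - l| `^ p)).
Proof.
move=> p1 a0.
have cf t : 0 < t -> {for t, continuous (fun t : R => `|- ln t - l| `^ p)}.
  move=> t0; apply: cont_pow => //; apply: cvgB; last exact: cvg_cst.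
  exact: continuous_logV.
exact: gt_continuous_integrable a0 cf.
Qed.

Let measurable_pow_logV p (A : set R) l :
  measurable_fun A (fun t => `|- ln t - l| `^ p).
Proof. by apply: measurable_pow_norm; exact: measurable_logV. Qed.

(** The average is [1 - ln d], so the centred function is [- ln (t / d) - 1] and [log_pow_le]
    applies directly. *)
Lemma log_osc0 p d : 1 < p -> 0 < d -> d <= 1 ->
  (\int[mu]_(t in `[0%R, d]) (`|- ln t - average 0 d logV| `^ p)%:E <=
   (jn_constant p * d)%:E)%E.
Proof.
move=> p1 d0 d1.
rewrite average_logV// {2}/xlogx mul0r !subr0 /xlogx mulrBr mulrA mulVf ?gt_eqF// mul1r.
apply: (@ge0_integral_le_lim R 0 d (fun t => `|- ln t - (1 - ln d)| `^ p) _ (fun=> 0)) => //.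
- exact: cvg_cst.
- exists 2%N => // n /= n2; rewrite addr0.
  have n1 : 1 < n%:R :> R by rewrite ltr1n.
  have a0 : 0 < exp_approach 0 d n%:R by exact: exp_approach_gt.
  rewrite -EFin_Rintegral//; last exact: integrable_pow_logV.
  rewrite lee_fin; have := log_pow_le p1 d0 n1; rewrite subr0; apply: le_trans.
  rewrite le_eqVlt; apply/orP; left; apply/eqP.
  apply: eq_Rintegral => t; rewrite inE /= in_itv/= => /andP[ta td].
  have t0 : 0 < t by exact: lt_le_trans ta.
  rewrite subr0 ln_div ?posrE//; congr (`|_| `^ _); lra.
Qed.

(* With [q] the rearrangement of [X - 1] to [[c, d]] and [g] the centred
   [- ln], the difference [q - g] is decreasing with mean zero and changes sign
   at [s], so it is positively correlated with [dpow p (g t)] (Chebyshev). *)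
Lemma log_osc_gt0 p c d : 1 < p -> 0 < c -> c < d -> d <= 1 ->
  (\int[mu]_(t in `[c, d]) (`|- ln t - average c d logV| `^ p)%:E <=
   (jn_constant p * (d - c))%:E)%E.
Proof.
move=> p1 c0 cd d1; set m := average c d logV.
have dc0 : 0 < d - c by rewrite subr_gt0.
have mE : m * (d - c) = xlogx d - xlogx c.
  by rewrite /m average_logV ?(ltW c0)// mulrC mulrA divff ?gt_eqF// mul1r.
pose k := m - 1 + ln (d - c).
(* Indeed [(d - c) * k = (d - c) * (ln (d - c) - ln d) + c * (ln c - ln d)]. Negativity makes [s]
   positive, and [s] is the zero of [q t - g t = ln t + k - ln (t - c)]. *)
have k0 : k < 0.
  rewrite -(ltr_pM2r dc0) mul0r /k.
  have h1 : ln (d - c) < ln d by rewrite ltr_ln ?posrE; lra.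
  have h2 : ln c < ln d by rewrite ltr_ln ?posrE; lra.
  have := ltr_pM2l dc0 (ln (d - c)) (ln d); rewrite h1 => h3.
  have := ltr_pM2l c0 (ln c) (ln d); rewrite h2 => h4.
  move: mE; rewrite /xlogx; lra.
have ek1 : expR k < 1 by rewrite expR_lt1.
have ek : 0 < 1 - expR k by rewrite subr_gt0.
pose s := c / (1 - expR k).
have s0 : 0 < s by rewrite divr_gt0.
pose g t := - ln t - m.
pose q t := - ln ((t - c) / (d - c)) - 1.
pose y := dpow p (g s).
(* Both [dpow p (g t) - y] and [q t - g t] are nonnegative up to [s] and nonpositive after it, so
   the slope in the tangent inequality may be replaced by the constant [y]. *)
have pointwise t : c < t -> `|g t| `^ p + y * (q t - g t) <= `|q t| `^ p.
  move=> ct; have t0 : 0 < t by lra.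
  have tc : 0 < t - c by lra.
  apply: le_trans (pow_tangent (q t) (g t) p1); rewrite lerD2l.
  have rE : q t - g t = ln t + k - ln (t - c).
    by rewrite /q /g /k ln_div ?posrE//; lra.
  have lnk : ln t + k = ln (t * expR k) by rewrite lnM ?posrE ?expR_gt0// expRK.
  have [ts|st] := leP t s.
    apply: ler_wpM2r.
      rewrite rE lnk subr_ge0 ler_ln ?posrE ?mulr_gt0 ?expR_gt0//.
      by move: ts; rewrite ler_pdivlMr//; lra.
    by apply: le_dpow => //; rewrite /g lerD2r lerN2 ler_ln.
  apply: ler_wnM2r.
    rewrite rE lnk subr_le0 ler_ln ?posrE ?mulr_gt0 ?expR_gt0//.
    by move: st; rewrite ltr_pdivrMr//; lra.
  by apply: le_dpow => //; rewrite /g lerD2r lerN2 ler_ln ?posrE// ltW.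
pose a (n : nat) := exp_approach c d n%:R.
(* This is [- y] times the integral of [q - g] over [[a n, d]]; it tends to 0 by [mE]. *)
pose r n := y * ((d - c) * (n%:R * expR (- n%:R)) +
  (xlogx d - xlogx (a n) - m * (d - a n))).
have ca n : c < a n by exact: exp_approach_gt.
have a_c : a n @[n --> \oo] --> c.
  have : a n @[n --> \oo] --> c + (d - c) * 0.
    by apply: cvgD; [exact: cvg_cst|apply: cvgMr; exact: cvg_expRNn].
  by rewrite mulr0 addr0.
have r0 : r n @[n --> \oo] --> 0.
  have -> : 0 = y * ((d - c) * 0 + (xlogx d - xlogx c - m * (d - c))).
    by rewrite mE; lra.
  apply: cvgMr; apply: cvgD; first by apply: cvgMr; exact: cvg_nexpRNn.
  apply: cvgB.
    apply: cvgB; first exact: cvg_cst.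
    have cx : {for c, continuous (@xlogx R)}.
      apply: cvgB; first exact: cvg_id.
      by apply: cvgM; [exact: cvg_id|exact: continuous_ln].
    exact: (continuous_cvg _ cx a_c).
  by apply: cvgMr; apply: cvgB; [exact: cvg_cst|exact: a_c].
apply: (@ge0_integral_le_lim R c d (fun t => `|- ln t - m| `^ p) _ r) => //.
exists 2%N => // n /= n2.
have n1 : 1 < n%:R :> R by rewrite ltr1n.
have an0 : 0 < a n by exact: lt_trans (ca n).
have ad : a n < d by apply: exp_approach_lt => //; lra.
have cq t : c < t -> {for t, continuous q}.
  move=> ct; apply: cvgB; last exact: cvg_cst.
  apply: cvgN; apply: continuous_comp.
    by apply: cvgMl; apply: cvgB; [exact: cvg_id|exact: cvg_cst].
  by apply: continuous_ln; rewrite divr_gt0// subr_gt0.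
have cg t : c < t -> {for t, continuous g}.
  move=> ct; apply: cvgB; last exact: cvg_cst.
  by apply: continuous_logV; lra.
have iq : mu.-integrable `[a n, d] (EFin \o q) by exact: gt_continuous_integrable (ca n) cq.
have ig : mu.-integrable `[a n, d] (EFin \o g) by exact: gt_continuous_integrable (ca n) cg.
have igp : mu.-integrable `[a n, d] (EFin \o (fun t => `|g t| `^ p)).
  have cf t : c < t -> {for t, continuous (fun t => `|g t| `^ p)}.
    by move=> ct; apply: cont_pow => //; exact: cg.
  exact: gt_continuous_integrable (ca n) cf.
have iqp : mu.-integrable `[a n, d] (EFin \o (fun t => `|q t| `^ p)).
  have cf t : c < t -> {for t, continuous (fun t => `|q t| `^ p)}.
    by move=> ct; apply: cont_pow => //; exact: cq.
  exact: gt_continuous_integrable (ca n) cf.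
have iD : mu.-integrable `[a n, d] (EFin \o (fun t => q t - g t)).
  exact: integrableRB.
have mua : fine (mu `[a n, d]) = d - a n.
  by rewrite lebesgue_measure_itv/= lte_fin ad.
have icst e : mu.-integrable `[a n, d] (EFin \o (fun=> e)).
  by apply: integrableRcst => //; exact: mu_itvcc_lty.
have Ig : \int[mu]_(t in `[a n, d]) g t = xlogx d - xlogx (a n) - m * (d - a n).
  rewrite /g RintegralB//; last first.
    exact: gt_continuous_integrable an0 (@continuous_logV R).
  by rewrite Rintegral_logV ?(ltW ad)// Rintegral_cst// mua.
have Iq : \int[mu]_(t in `[a n, d]) q t = - (d - c) * (n%:R * expR (- n%:R)).
  have -> : \int[mu]_(t in `[a n, d]) q t =
      \int[mu]_(t in `[a n, d]) (- ln (t - c) - (1 - ln (d - c))).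
    apply: eq_Rintegral => t; rewrite inE /= in_itv/= => /andP[ta _].
    have tc : 0 < t - c by rewrite subr_gt0 (lt_le_trans (ca n)).
    by rewrite /q ln_div ?posrE//; lra.
  rewrite RintegralB//; last first.
    have cf t : c < t -> {for t, continuous (fun t : R => - ln (t - c))}.
      by move=> ct; apply/continuousN/continuous_lnB.
    exact: gt_continuous_integrable (ca n) cf.
  rewrite Rintegral_lnB ?(ltW ad)// Rintegral_cst// mua.
  rewrite /xlogx /a /exp_approach [c + _ - c]addrAC subrr add0r.
  rewrite lnM ?posrE ?expR_gt0// expRK; lra.
have main : \int[mu]_(t in `[a n, d]) (`|g t| `^ p) +
    y * \int[mu]_(t in `[a n, d]) (q t - g t) <= jn_constant p * (d - c).
  apply: le_trans (log_pow_le p1 cd n1).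
  rewrite -RintegralZl// -RintegralD//; last exact: integrableRZ.
  apply: le_Rintegral => //; first by apply: integrableRD => //; exact: integrableRZ.
  move=> t; rewrite /= in_itv/= => /andP[ta _]; apply: pointwise.
  exact: lt_le_trans ta.
rewrite -EFin_Rintegral// lee_fin.
move: main; rewrite RintegralB// Ig Iq /r; lra.
Qed.

Lemma log_osc p c d : 1 < p -> 0 <= c -> c < d -> d <= 1 ->
  (\int[mu]_(t in `[c, d]) (`|- ln t - average c d logV| `^ p)%:E <=
   (jn_constant p * (d - c))%:E)%E.
Proof.
move=> p1; rewrite le_eqVlt => /predU1P[<-|c0] cd d1; last exact: log_osc_gt0.
by have := log_osc0 p1 cd d1; rewrite subr0.
Qed.

Lemma log_bmo_norm p : 1 < p ->
  (bmo_norm p 0 1 logV <= (jn_constant p `^ p^-1)%:E)%E.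
Proof.
move=> p1; have p0 : 0 < p by lra.
apply: ge_ereal_sup => _ [c [d [c0 cd d1 ->]]].
have dc0 : 0 < d - c by rewrite subr_gt0.
set A := eaverage _ _ _.
have A0 : (0 <= A)%E.
  rewrite mule_ge0 ?lee_fin ?invr_ge0 ?(ltW dc0)//.
  by apply: integral_ge0 => t _; rewrite lee_fin powR_ge0.
have : (A <= (jn_constant p)%:E)%E.
  rewrite lee_pdivrMl// -EFinM mulrC; exact: log_osc.
case: A A0 => [A| |] A0 AJ; last 2 first.
- by move: AJ; rewrite leye_eq.
- by move: A0; rewrite leeNy_eq.
rewrite !lee_fin in A0 AJ.
rewrite poweR_EFin lee_fin ge0_ler_powR ?nnegrE ?invr_ge0 ?(ltW p0)//.
exact: jn_constant_ge0.
Qed.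

(** On [[expR (- n), 1]] the integrand is the inverse of [t], whose integral there is [n]. *)
Lemma eaverage_expR_logV : eaverage 0 1 (expR \o logV) = +oo%E.
Proof.
rewrite /eaverage subr0 invr1 mul1e.
apply/eqyP => B B0.
pose n := (Num.trunc B).+1; pose a : R := expR (- n%:R).
have a0 : 0 < a := expR_gt0 _.
have a1 : a < 1 by rewrite expR_lt1 oppr_lt0 ltr0n.
apply: (@le_trans _ _ (\int[mu]_(t in `[a, 1%R]) (t^-1)%:E)%E).
  by rewrite Rintegral_invr// ln1 sub0r expRK opprK lee_fin ltW// truncnS_gt.
have -> : (\int[mu]_(t in `[a, 1%R]) (t^-1)%:E =
    \int[mu]_(t in `[a, 1%R]) ((expR \o logV) t)%:E)%E.
  apply: eq_integral => t; rewrite inE /= in_itv/= => /andP[ta _].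
  by rewrite expRN lnK// posrE (lt_le_trans a0).
apply: ge0_subset_integral => //.
- apply/measurable_EFinP; apply: (measurableT_comp (@measurable_expR R)).
  exact: measurable_logV.
- by move=> t _; rewrite lee_fin expR_ge0.
- by move=> t; rewrite /= !in_itv/= => /andP[ta ->]; rewrite andbT ltW// (lt_le_trans a0).
Qed.

(** The property fails at the constant itself, so no larger number can belong to
    [john_nirenberg_below p]. *)
Lemma not_john_nirenberg_at p : 1 < p ->
  ~ john_nirenberg_at p (jn_constant p `^ p^-1 : R).
Proof.
move=> p1 [C C0 /(_ 0 1 logV ltr01)].
have := log_bmo_norm p1 => H.
have B : BMO p 0 1 logV by split; [exact: integrable_logV|exact: le_lt_trans H (ltry _)].
move=> /(_ B H 0 1 (lexx _) ltr01 (lexx _)).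
by rewrite eaverage_expR_logV.
Qed.

End LogOsc.

Unset Implicit Arguments.

Theorem theorem1p2 (R : realType) (p : R) (hp : 2 < p) :
  is_john_nirenberg_constant p
    ((p / expR 1 *
      (Gamma p -
       \int[@lebesgue_measure R]_(t in `[0, 1]) (t `^ (p - 1) * expR t)) + 1)
     `^ p^-1).
Proof.
have p1 : 1 < p by lra.
have p0 : 0 < p by lra.
have J0 := jn_constant_ge0 p1.
rewrite -/(jn_constant p); split.
- move=> e /andP[e0 eJ]; apply: john_nirenberg_lower => //.
  have -> : jn_constant p = (jn_constant p `^ p^-1) `^ p.
    by rewrite -powRrM mulVf ?gt_eqF// powRr1.
  by rewrite gt0_ltr_powR ?nnegrE ?powR_ge0.
- move=> e He; rewrite leNgt; apply/negP => Je.
  by apply: (not_john_nirenberg_at p1); apply: He; rewrite powR_ge0.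
Qed.
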